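(* Let $\Sigma$ be an oriented 2-manifold and let $\mathcal G_+,\mathcal G_-:\Sigma\to\mathbb C\cup\{\infty\}$ be two smooth complex functions such that $\mathcal G_+\neq\mathcal G_-$ everywhere. Then there exists a frontal $\mathbf X:\Sigma\to\mathbb H^3$ with hyperbolic Gauss maps $\mathcal G_+$ and $\mathcal G_-$ if and only if $$\Re\left(\int_\gamma\frac{d\mathcal G_+}{\mathcal G_+-\mathcal G_-}\right)=0\qquad\text{for any loop }\gamma\text{ in }\Sigma .$$ Moreover, in this case $\mathbf X$ and its unit normal $\mathbf N$ can be written as $$\mathbf X=-\frac1{2\rho^+}(1,\Pi^{-1}\circ\mathcal G_+)-\frac1{2\rho^-}(1,\Pi^{-1}\circ\mathcal G_-),\qquad \mathbf N=-\frac1{2\rho^+}(1,\Pi^{-1}\circ\mathcal G_+)+\frac1{2\rho^-}(1,\Pi^{-1}\circ\mathcal G_-),$$ where $$\rho^+=\frac{|\xi_+|^2}{1+|\mathcal G_+|^2},\quad \xi_+=c_0\exp\Big(\int\frac{d\mathcal G_+}{\mathcal G_+-\mathcal G_-}\Big),\qquad \rho^-=\frac{|\xi_-|^2}{1+|\mathcal G_-|^2},\quad \xi_-=c_1\exp\Big(\int\frac{d\mathcal G_-}{\mathcal G_--\mathcal G_+}\Big),$$ and $c_0,c_1$ are non-zero complex numbers such that $\xi_+\xi_-=\mathcal G_+-\mathcal G_-$.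
   Context: $\Re$ denotes the real part. $\mathbb L^4=\mathbb R\times\mathbb R^3$ carries the Lorentz metric $\ll(a,\mathbf p),(b,\mathbf q)\gg=-ab+\langle\mathbf p,\mathbf q\rangle$, and $\mathbb H^3=\{\mathbf r\in\mathbb L^4:\ll\mathbf r,\mathbf r\gg=-1\}$ is the hyperboloid model of hyperbolic space. A smooth map $\mathbf X=(r,\mathbf x):\Sigma\to\mathbb H^3$ is a frontal if there is a smooth $\mathbf N=(s,\mathbf n):\Sigma\to\mathbb L^4$ (its unit normal) with $\ll\mathbf N,\mathbf N\gg=1$, $\ll\mathbf N,\mathbf X\gg=0$, $\ll d\mathbf X,\mathbf N\gg=0$; then $r^2\neq s^2$ and one defines $\mathcal N^\pm:\Sigma\to\mathbb S^2$ by $\mathbf X\pm\mathbf N=(r\pm s)(1,\mathcal N^\pm)$. The hyperbolic Gauss maps of $\mathbf X$ are $\mathcal G_\pm=\Pi\circ\mathcal N^\pm$, where $\Pi:\mathbb S^2\to\mathbb C\cup\{\infty\}$ is the usual stereographic projection. Only $|\xi_\pm|$ enters the formulas for $\mathbf X$ and $\mathbf N$.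
   Formalization: Where G₊ or G₋ is ∞, the integrals and formulas are read in a rotated coordinate of the sphere (the period condition is asked for all rotations); since the formula forces r<0, a frontal with r>0 has (−X,−N), rather than (X,N), given by it. *)

(* Defs.v *)
From HB Require Import structures.
From mathcomp Require Import all_boot all_order all_algebra.
From mathcomp Require Import complex.
From mathcomp Require Import all_classical all_reals all_analysis.

Set Implicit Arguments.
Unset Strict Implicit.
Unset Printing Implicit Defensive.

Import Order.TTheory GRing.Theory Num.Theory.
Import numFieldNormedType.Exports.
Local Open Scope classical_set_scope.
Local Open Scope ring_scope.
Local Open Scope complex_scope.

Notation normc := ComplexField.Normc.normc.

Section Smooth.
Context {R : realType} {V W : normedModType R}.

(* [U] is meant to be open: all directional derivatives of order at most [k]
   exist and are continuous at the points of [U]. *)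
Fixpoint Ck_on (k : nat) (U : set V) (f : V -> W) : Prop :=
  (forall x, U x -> {for x, continuous f}) /\
  (if k is k'.+1
   then forall v, (forall x, U x -> derivable f x v) /\ Ck_on k' U ('D_v f)
   else True).

Definition smooth_on (U : set V) (f : V -> W) : Prop := forall k, Ck_on k U f.

End Smooth.

(* A positively oriented smooth atlas on S.  Only [chart i] on [dom i] and
   [param i] on [chart i @` dom i] are meaningful. *)
Record oriented_surface (R : realType) (S : topologicalType) := OrientedSurface {
  idx : Type;
  dom : idx -> set S;
  chart : idx -> S -> 'rV[R]_2;
  param : idx -> 'rV[R]_2 -> S;
  surf_hausdorff : hausdorff_space S;
  surf_second_countable : @second_countable S;
  surf_cover : forall p, exists i, dom i p;
  dom_open : forall i, open (dom i);
  chart_open : forall i, open (chart i @` dom i);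
  chartK : forall i p, dom i p -> param i (chart i p) = p;
  chart_cts : forall i p, dom i p -> {for p, continuous (chart i)};
  param_cts : forall i x, (chart i @` dom i) x -> {for x, continuous (param i)};
  transition_smooth : forall i j,
    smooth_on (chart i @` (dom i `&` dom j)) (chart j \o param i);
  transition_oriented : forall i j x, (chart i @` (dom i `&` dom j)) x ->
    0 < \det (jacobian (chart j \o param i) x) }.
Arguments idx {R S} _.
Arguments dom {R S} _ _.
Arguments chart {R S} _ _.
Arguments param {R S} _ _.

Section Surface.
Context {R : realType} {S : topologicalType} (M : oriented_surface R S).

Definition smooth_map (W : normedModType R) (f : S -> W) : Prop :=
  forall i, smooth_on (chart M i @` dom M i) (f \o param M i).

Definition smooth_curve (U : set R) (a : R -> S) : Prop :=
  (forall t, U t -> {for t, continuous a}) /\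
  forall i, smooth_on (U `&` a @^-1` dom M i) (chart M i \o a).

(* Smooth on the closed interval [0, 1], i.e. on an open neighbourhood of it. *)
Definition smooth_arc (a : R -> S) : Prop :=
  exists U : set R, [/\ open U, `[0, 1]%classic `<=` U & smooth_curve U a].

(* A piecewise smooth path from p to q, given by the list of its smooth pieces,
   each parametrized by [0, 1]; the empty list is the constant path. *)
Fixpoint is_path (p : S) (c : seq (R -> S)) (q : S) : Prop :=
  if c is a :: c' then [/\ smooth_arc a, a 0 = p & is_path (a 1) c' q]
  else p = q.

Fixpoint along (c : seq (R -> S)) (P : S -> Prop) : Prop :=
  if c is a :: c' then (forall t, 0 <= t <= 1 -> P (a t)) /\ along c' P
  else True.

End Surface.

Section Sphere.
Context {R : realType}.

(* C u {oo}, with [None] the point at infinity. *)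
Definition riemann_sphere : Type := option R[i].

Definition affine (z : riemann_sphere) : R[i] := odflt 0 z.

Definition vec3 (a b c : R) : 'rV[R]_3 := \row_(i < 3) nth 0 [:: a; b; c] i.

Definition dot (u v : 'rV[R]_3) : R := \sum_(i < 3) u 0 i * v 0 i.

(* Stereographic projection from the north pole (0, 0, 1). *)
Definition stereo (x : 'rV[R]_3) : riemann_sphere :=
  if x 0 (inord 2) == 1 then None
  else Some ((x 0 (inord 0) / (1 - x 0 (inord 2)))
             +i* (x 0 (inord 1) / (1 - x 0 (inord 2)))).

Definition stereo_inv (z : riemann_sphere) : 'rV[R]_3 :=
  if z is Some w then
    (1 + normc w ^+ 2)^-1 *:
      vec3 (2 * complex.Re w) (2 * complex.Im w) (normc w ^+ 2 - 1)
  else vec3 0 0 1.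

(* The rotation z |-> (a z + b) / (- b^* z + a^* ) of the Riemann sphere; it is
   only used with |a|^2 + |b|^2 = 1. *)
Definition rotation (a b : R[i]) (z : riemann_sphere) : riemann_sphere :=
  if z is Some w then
    if - b^* * w + a^* == 0 then None
    else Some ((a * w + b) / (- b^* * w + a^*))
  else if b == 0 then None else Some (- (a / b^*)).

Definition cexp (z : R[i]) : R[i] :=
  (expR (complex.Re z) * cos (complex.Im z))
  +i* (expR (complex.Re z) * sin (complex.Im z)).

Definition cderive (f : R -> R[i]) (t : R) : R[i] :=
  (derive1 (fun s => complex.Re (f s)) t)
  +i* (derive1 (fun s => complex.Im (f s)) t).

Definition cintegral01 (f : R -> R[i]) : R[i] :=
  (\int[lebesgue_measure]_(t in `[0, 1]) complex.Re (f t))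
  +i* (\int[lebesgue_measure]_(t in `[0, 1]) complex.Im (f t)).

(* The integral of dg / (g - h) along a path on which g is finite; the
   integrand is 0 where h is infinite. *)
Definition path_integral (S : Type) (g h : S -> riemann_sphere)
    (c : seq (R -> S)) : R[i] :=
  \sum_(a <- c) cintegral01 (fun t =>
    if h (a t) is Some w
    then cderive (affine \o g \o a) t / (affine (g (a t)) - w)
    else 0).

End Sphere.
Arguments riemann_sphere : clear implicits.

Section Lorentz.
Context {R : realType}.

(* L^4 = R x R^3 *)
Definition lorentz (u v : R * 'rV[R]_3) : R := - (u.1 * v.1) + dot u.2 v.2.

Context {S : topologicalType} (M : oriented_surface R S).

(* X is a frontal into the (two-sheeted) hyperboloid H^3 and N is its unit
   normal; the last clause is <<dX, N>> = 0, read in the charts. *)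
Definition frontal_with_normal (X N : S -> R * 'rV[R]_3) : Prop :=
  [/\ smooth_map M X /\ (forall p, lorentz (X p) (X p) = -1),
      smooth_map M N,
      forall p, lorentz (N p) (N p) = 1,
      forall p, lorentz (N p) (X p) = 0
    & forall i x v, (chart M i @` dom M i) x ->
        lorentz ('D_v (X \o param M i) x) (N (param M i x)) = 0].

(* Pi \o N^+ and Pi \o N^-, with X +- N = (r +- s)(1, N^+-). *)
Definition gauss_plus (X N : S -> R * 'rV[R]_3) (p : S) : riemann_sphere R :=
  stereo (((X p).1 + (N p).1)^-1 *: ((X p).2 + (N p).2)).

Definition gauss_minus (X N : S -> R * 'rV[R]_3) (p : S) : riemann_sphere R :=
  stereo (((X p).1 - (N p).1)^-1 *: ((X p).2 - (N p).2)).

Definition gauss_maps_are (X N : S -> R * 'rV[R]_3)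
    (Gp Gm : S -> riemann_sphere R) : Prop :=
  (forall p, gauss_plus X N p = Gp p) /\ (forall p, gauss_minus X N p = Gm p).

(* Smoothness into C u {oo}, the smooth structure being that of S^2. *)
Definition smooth_to_sphere (G : S -> riemann_sphere R) : Prop :=
  smooth_map M (stereo_inv \o G).

(* Re of the integral of dGp / (Gp - Gm) vanishes for all loops.  The form has
   no meaning where Gp is infinite.  A rotation z |-> (a z + b)/(- b^* z + a^* )
   of the sphere changes it by - dlog (- b^* Gp + a^* ), which does not affect
   the real part of a period, and every loop avoids the value oo for some
   rotated Gp; hence the integral over a loop through poles of Gp is read in
   rotated coordinates.  The case a = 1, b = 0 is the original form. *)
Definition period_condition (Gp Gm : S -> riemann_sphere R) : Prop :=
  forall a b : R[i], normc a ^+ 2 + normc b ^+ 2 = 1 ->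
  let g := rotation a b \o Gp in
  let h := rotation a b \o Gm in
  forall p c, is_path M p c p -> along c (fun q => g q <> None) ->
  complex.Re (path_integral g h c) = 0.

(* The representation formulas on the paths issued from p0, the primitives
   being the integrals from p0.  They are written in the rotated coordinate of
   parameters a, b (see [period_condition]); this affects neither rho^+ and
   rho^- nor the condition xi_+ xi_- = G_+ - G_-. *)
Definition represented (Gp Gm : S -> riemann_sphere R)
    (X N : S -> R * 'rV[R]_3) (a b : R[i]) (p0 : S) (c0 c1 : R[i]) : Prop :=
  let g := rotation a b \o Gp in
  let h := rotation a b \o Gm in
  forall c q, is_path M p0 c q ->
  along c (fun q' => g q' <> None /\ h q' <> None) ->
  let xip := c0 * cexp (path_integral g h c) in
  let xim := c1 * cexp (path_integral h g c) in
  let rhop := normc xip ^+ 2 / (1 + normc (affine (g q)) ^+ 2) in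
  let rhom := normc xim ^+ 2 / (1 + normc (affine (h q)) ^+ 2) in
  [/\ xip * xim = affine (g q) - affine (h q),
      X q = - (1 / (2 * rhop)) *: (1, stereo_inv (Gp q))
            - (1 / (2 * rhom)) *: (1, stereo_inv (Gm q))
    & N q = - (1 / (2 * rhop)) *: (1, stereo_inv (Gp q))
            + (1 / (2 * rhom)) *: (1, stereo_inv (Gm q))].

End Lorentz.

(* Main.v *)
(** Write n+ and n- for the maps to the sphere corresponding to G+ and G-.  Since
X + N and X - N are null, a frontal with these Gauss maps has the form
X = al (1, n+) + be (1, n-) and N = al (1, n+) - be (1, n-), where
<<X, X>> = -1 fixes the product al be.  The contact condition <<dX, N>> = 0 then
says exactly that d al = al w for the 1-form
w = <dn+, n-> / (1 - <n+, n->).  Hence the frontal exists iff the smooth form w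
is exact, and w is invariant under rotations of the sphere.

In stereographic coordinates (g, h) one has
2 Re (dg / (g - h)) = - w - dlog (1 - n+_3), so the period condition says that w
has no periods along the loops on which g is finite.  A piecewise smooth loop is
a finite union of Lipschitz curves, so its image under n+ is not the whole sphere,
and a rotation moves a missed point to infinity: all periods of w vanish.  The
same identity expresses al, and then be, through |xi+| and |xi-|; the relation
xi+ xi- = g - h follows from d (g - h) = (g - h) (dg / (g - h) + dh / (h - g)). *)
From HB Require Import structures.
Require Import Defs.
From mathcomp Require Import all_boot all_order all_algebra.
From mathcomp Require Import complex.
From mathcomp Require Import all_classical all_reals all_analysis.
From mathcomp Require Import ring lra.
Set Implicit Arguments.
Unset Strict Implicit.
Unset Printing Implicit Defensive.
Import Order.TTheory GRing.Theory Num.Theory.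
Import numFieldNormedType.Exports.
Local Open Scope classical_set_scope.
Local Open Scope ring_scope.
Local Open Scope complex_scope.

(** * Smooth maps on normed modules *)

(** The infinite values of the Gauss maps shape the proof. Whatever must be smooth on the whole
    surface (w, its primitive, al, be) is therefore built from the unit vectors n+ and n-, the only
    denominators being powers of 1 - <n+, n-> and of al, which vanish nowhere; stereographic
    coordinates occur only along paths on which they are finite.

    The point missed by a loop is found by counting rather than by measure: finitely many Lipschitz
    curves cannot pass through all points of a fine enough grid. The grid lies in a small square of
    the plane of the first two coordinates, over which the upper hemisphere is a graph.

    Smoothness is stated with iterated directional derivatives, which by themselves give neither a
    chain rule nor continuity; both are recovered in the plane from the continuity of the partial
    derivatives.

    Since rho^+ and rho^- are positive, the representation formulas always lie on the sheet of
    negative time coordinate. A frontal on the other sheet is represented after the change of sign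
    of X and N. *)

Section DirectionalDerivatives.
Context {R : realType}.

Section Reparametrization.
Context {V V' W : normedModType R} (phi : V' -> V) (x : V') (u : V') (v : V).
Hypothesis phiE : forall h : R, phi (h *: u + x) = h *: v + phi x.

(** Under [phiE] the two difference quotients are the same function of [h], so that no chain rule is
    involved. *)
Lemma derivable_reparam (f : V -> W) :
  derivable (f \o phi) x u <-> derivable f (phi x) v.
Proof. by rewrite /derivable; under eq_fun do rewrite /= phiE. Qed.

Lemma derive_reparam (f : V -> W) : 'D_u (f \o phi) x = 'D_v f (phi x).
Proof. by rewrite /derive; under eq_fun do rewrite /= phiE. Qed.

Lemma is_derive_reparam (f : V -> W) df :
  is_derive x u (f \o phi) df <-> is_derive (phi x) v f df.
Proof.
split=> -[fd <-]; split.
- exact/derivable_reparam.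
- by rewrite derive_reparam.
- exact/derivable_reparam.
- by rewrite derive_reparam.
Qed.

End Reparametrization.

Lemma is_derive_line {V W : normedModType R} (f : V -> W) (x v : V) (t : R) df :
  is_derive t 1 (fun s => f (s *: v + x)) df <-> is_derive (t *: v + x) v f df.
Proof.
apply: (@is_derive_reparam _ _ _ (fun s : R => s *: v + x)) => h.
by rewrite [h *: 1]mulr1 scalerDl addrA.
Qed.

Lemma is_derive_line0 {V W : normedModType R} (f : V -> W) (x v : V) df :
  is_derive (0 : R) (1 : R) (fun s : R => f (s *: v + x)) df <-> is_derive x v f df.
Proof.
by have := @is_derive_line _ _ f x v 0 df; rewrite scale0r add0r.
Qed.

(** Restricted to the line through [x] along [v], [f] is a derivable function of one real variable,
    hence differentiable there, and its differential is linear in [c]; this includes [c = 0]. *)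
Lemma is_derive_scale {V W : normedModType R} (f : V -> W) (x v : V) (c : R) df :
  is_derive x v f df -> is_derive x (c *: v) f (c *: df).
Proof.
move=> /is_derive_line0 gd.
have /derivable1_diffP dg := @ex_derive _ _ _ _ _ _ _ gd.
have gc : is_derive (0 : R) c (fun s => f (s *: v + x)) (c *: df).
  apply: DeriveDef; first exact: diff_derivable.
  rewrite deriveE// -[c in LHS]mulr1 [LHS]linearZ -deriveE//.
  by rewrite derive_val.
have E (h : R) : (h *: c + 0) *: v + x = h *: (c *: v) + (0 *: v + x).
  by rewrite addr0 scalerA scale0r add0r.
have := (@is_derive_reparam _ _ _ (fun s : R => s *: v + x) 0 c (c *: v) E f
  (c *: df)).1 gc.
by rewrite scale0r add0r.
Qed.

Lemma is_derive_linear {V W W' : normedModType R} (L : {linear W -> W'})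
    (f : V -> W) (x v : V) df :
  continuous L -> is_derive x v f df -> is_derive x v (L \o f) (L df).
Proof.
move=> cL [/cvg_ex[/= l fl] <-].
have Dl : 'D_v f x = l by apply: cvg_lim fl.
have E : (fun h => h^-1 *: ((L \o f \o shift x) (h *: v) - (L \o f) x)) =
    L \o (fun h => h^-1 *: ((f \o shift x) (h *: v) - f x)).
  by apply/funext => h /=; rewrite [RHS]linearZ/= (raddfB L).
have Lfl : h^-1 *: ((L \o f \o shift x) (h *: v) - (L \o f) x) @[h --> 0^']
    --> L l.
  by rewrite E; apply: continuous_cvg => //; exact: cL.
rewrite Dl; split; first by apply/cvg_ex; exists (L l).
by apply: cvg_lim Lfl.
Qed.

Lemma is_derive_comp {V : normedModType R} (g : R -> R) (f : V -> R) (x v : V)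
    dg df :
  is_derive x v f df -> is_derive (f x) 1 g dg ->
  is_derive x v (g \o f) (dg * df).
Proof.
move=> /is_derive_line0 fd gd; apply/is_derive_line0.
apply: (@is_derive1_comp _ g (fun s : R => f (s *: v + x))).
by rewrite scale0r add0r.
Qed.

End DirectionalDerivatives.

(** * Closure properties of functions of class C^k *)

Section CkCalculus.
Context {R : realType} {V : normedModType R}.

Lemma Ck_on_cts {W : normedModType R} k (U : set V) (f : V -> W) x :
  Ck_on k U f -> U x -> {for x, continuous f}.
Proof. by case: k => [|k] [fc _] /fc. Qed.

Lemma Ck_on_derivable {W : normedModType R} k (U : set V) (f : V -> W) x v :
  Ck_on k.+1 U f -> U x -> derivable f x v.
Proof. by move=> [_ /(_ v)[fd _]] /fd. Qed.

Lemma Ck_on_derive {W : normedModType R} k (U : set V) (f : V -> W) v :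
  Ck_on k.+1 U f -> Ck_on k U ('D_v f).
Proof. by move=> [_ /(_ v)[]]. Qed.

Lemma Ck_onW {W : normedModType R} k (U : set V) (f : V -> W) :
  Ck_on k.+1 U f -> Ck_on k U f.
Proof.
elim: k f => [|k IH] f [fc fd]; first by split.
split=> // v; have [fdv kf] := fd v; split=> //; exact: IH.
Qed.

Lemma eq_Ck_on {W : normedModType R} k (U : set V) (f g : V -> W) :
  open U -> (forall x, U x -> f x = g x) -> Ck_on k U f -> Ck_on k U g.
Proof.
move=> oU; elim: k f g => [|k IH] f g fg [fc fd].
  all: have nfg x : U x -> \near x, f x = g x.
  1,3: by move=> Ux; apply: filterS (open_nbhs_nbhs (conj oU Ux)).
  all: have gc x : U x -> {for x, continuous g}.
  1,3: move=> Ux; rewrite /prop_for /continuous_at -(fg _ Ux).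
  1,2: apply: cvg_trans (fc _ Ux); apply: near_eq_cvg.
  1,2: exact: nfg.
- by split.
- split=> // v; have [fdv kf] := fd v; split.
    by move=> x Ux; apply: (near_eq_derivable (nfg _ Ux)); exact: fdv.
  by apply: IH kf => x Ux; apply: near_eq_derive; exact: nfg.
Qed.

(** The induction rule behind the closure lemmas: a closed formula for the derivatives, valid on the
    open set [U] only, can replace the globally defined ['D_v f]. *)
Lemma Ck_on_intro {W : normedModType R} k (U : set V) (f : V -> W)
    (df : V -> V -> W) : open U ->
  (forall x, U x -> {for x, continuous f}) ->
  (forall v x, U x -> is_derive x v f (df v x)) ->
  (forall v, Ck_on k U (df v)) -> Ck_on k.+1 U f.
Proof.
move=> oU fc fd kdf; split=> // v; split.
  by move=> x Ux; exact: (@ex_derive _ _ _ _ _ _ _ (fd v x Ux)).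
apply: eq_Ck_on (kdf v) => // x Ux.
by have [_ ->] := fd v x Ux.
Qed.

Lemma Ck_on_is_derive {W : normedModType R} k (U : set V) (f : V -> W) v x :
  Ck_on k.+1 U f -> U x -> is_derive x v f ('D_v f x).
Proof. by move=> kf Ux; apply/derivableP; exact: Ck_on_derivable kf Ux. Qed.

Lemma Ck_on_cst {W : normedModType R} k (U : set V) (c : W) :
  open U -> Ck_on k U (fun=> c).
Proof.
move=> oU; elim: k c => [|k IH] c; first by split=> // x _; exact: cst_continuous.
apply: (@Ck_on_intro _ _ _ _ (fun _ _ => 0)) => // x _; exact: cst_continuous.
Qed.

Lemma Ck_onD {W : normedModType R} k (U : set V) (f g : V -> W) : open U ->
  Ck_on k U f -> Ck_on k U g -> Ck_on k U (fun x => f x + g x).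
Proof.
move=> oU; elim: k f g => [|k IH] f g kf kg.
  split=> // x Ux.
  by apply: (@cvgD _ W); [exact: Ck_on_cts kf Ux|exact: Ck_on_cts kg Ux].
apply: (@Ck_on_intro _ _ _ _ (fun v x => 'D_v f x + 'D_v g x)) => //.
- move=> x Ux.
  by apply: (@cvgD _ W); [exact: Ck_on_cts kf Ux|exact: Ck_on_cts kg Ux].
- move=> v x Ux; apply: (@is_deriveD _ _ _ f g);
    by [exact: Ck_on_is_derive kf Ux|exact: Ck_on_is_derive kg Ux].
- by move=> v; apply: IH; exact: Ck_on_derive.
Qed.

Lemma Ck_on_linear {W W' : normedModType R} (L : {linear W -> W'}) k (U : set V)
    (f : V -> W) : continuous L -> open U ->
  Ck_on k U f -> Ck_on k U (L \o f).
Proof.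
move=> cL oU; elim: k f => [|k IH] f kf.
  split=> // x Ux; apply: continuous_comp; last exact: cL.
  exact: Ck_on_cts kf Ux.
apply: (@Ck_on_intro _ _ _ _ (fun v => L \o 'D_v f)) => //.
- move=> x Ux; apply: continuous_comp; last exact: cL.
  exact: Ck_on_cts kf Ux.
- move=> v x Ux; apply: is_derive_linear => //.
  exact: Ck_on_is_derive kf Ux.
- by move=> v; apply: IH; exact: Ck_on_derive.
Qed.

Lemma Ck_onM k (U : set V) (f g : V -> R) : open U ->
  Ck_on k U f -> Ck_on k U g -> Ck_on k U (fun x => f x * g x).
Proof.
move=> oU; elim: k f g => [|k IH] f g kf kg.
  split=> // x Ux.
  by apply: cvgM; [exact: Ck_on_cts kf Ux|exact: Ck_on_cts kg Ux].
apply: (@Ck_on_intro _ _ _ _ (fun v x => f x * 'D_v g x + g x * 'D_v f x)) => //.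
- move=> x Ux.
  by apply: cvgM; [exact: Ck_on_cts kf Ux|exact: Ck_on_cts kg Ux].
- move=> v x Ux; apply: (@is_deriveM _ _ f g);
    by [exact: Ck_on_is_derive kf Ux|exact: Ck_on_is_derive kg Ux].
- move=> v; apply: Ck_onD => //; apply: IH;
    by [exact: Ck_onW|exact: Ck_on_derive].
Qed.

Lemma Ck_onN k (U : set V) (f : V -> R) : open U ->
  Ck_on k U f -> Ck_on k U (fun x => - f x).
Proof.
move=> oU kf; apply: (@eq_Ck_on _ _ _ (fun x => -1 * f x)) => //.
  by move=> x _; rewrite mulN1r.
by apply: Ck_onM => //; exact: Ck_on_cst.
Qed.

Lemma Ck_onV k (U : set V) (f : V -> R) : open U ->
  (forall x, U x -> f x != 0) -> Ck_on k U f -> Ck_on k U (fun x => (f x)^-1).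
Proof.
move=> oU f0; elim: k => [|k IH] kf.
  by split=> // x Ux; apply: cvgV; [exact: f0|exact: Ck_on_cts kf Ux].
apply: (@Ck_on_intro _ _ _ _ (fun v x => - ((f x)^-1 * (f x)^-1) * 'D_v f x)) => //.
- by move=> x Ux; apply: cvgV; [exact: f0|exact: Ck_on_cts kf Ux].
- move=> v x Ux; have fd : derivable f x v by exact: Ck_on_derivable kf Ux.
  split.
    by apply: derivableV => //; exact: f0.
  by rewrite deriveV ?f0// -exprVn.
- move=> v; have kV := IH (Ck_onW kf).
  apply: Ck_onM => //; last exact: Ck_on_derive.
  by apply: Ck_onN => //; exact: Ck_onM.
Qed.

Lemma Ck_on_expR k (U : set V) (f : V -> R) : open U ->
  Ck_on k U f -> Ck_on k U (fun x => expR (f x)).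
Proof.
move=> oU; elim: k => [|k IH] kf.
  split=> // x Ux; apply: (@continuous_comp _ _ _ f expR); last exact: continuous_expR.
  exact: Ck_on_cts kf Ux.
apply: (@Ck_on_intro _ _ _ _ (fun v x => expR (f x) * 'D_v f x)) => //.
- move=> x Ux; apply: (@continuous_comp _ _ _ f expR); last exact: continuous_expR.
  exact: Ck_on_cts kf Ux.
- move=> v x Ux; apply: (@is_derive_comp _ _ expR f).
  exact: Ck_on_is_derive kf Ux.
- move=> v; apply: Ck_onM => //; first by apply: IH; exact: Ck_onW.
  exact: Ck_on_derive.
Qed.

Lemma Ck_on_sum {W : normedModType R} k (U : set V) n (f : 'I_n -> V -> W) :
  open U -> (forall i, Ck_on k U (f i)) -> Ck_on k U (fun x => \sum_(i < n) f i x).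
Proof.
move=> oU; elim: n f => [|n IH] f kf.
  apply: (@eq_Ck_on _ _ _ (fun=> 0)) => //; last exact: Ck_on_cst.
  by move=> x _; rewrite big_ord0.
apply: (@eq_Ck_on _ _ _ (fun x => f ord0 x + \sum_(i < n) f (lift ord0 i) x)) => //.
  by move=> x _; rewrite big_ord_recl.
by apply: Ck_onD => //; exact: IH.
Qed.

End CkCalculus.

(** For an affine [phi] the derivative of [f \o phi] along [u] is ['D_(L u) f \o phi], a composition
    of the same shape, so the induction on [k] stays inside the statement. *)
Lemma Ck_on_affine {R : realType} {V V' W : normedModType R} k (U : set V)
    (f : V -> W) (phi : V' -> V) (L : V' -> V) (U' : set V') :
  (forall h u x, phi (h *: u + x) = h *: L u + phi x) -> continuous phi ->
  U' `<=` phi @^-1` U -> Ck_on k U f -> Ck_on k U' (f \o phi).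
Proof.
move=> phiE cphi sU; elim: k f => [|k IH] f kf.
  split=> // x Ux; apply: continuous_comp; first exact: cphi.
  exact: Ck_on_cts kf (sU _ Ux).
split=> [x Ux|u].
  apply: continuous_comp; first exact: cphi.
  exact: Ck_on_cts kf (sU _ Ux).
split=> [x Ux|].
  apply/(@derivable_reparam _ _ _ _ _ _ _ (L u)) => //.
  exact: Ck_on_derivable kf (sU _ Ux).
rewrite (_ : 'D_u (f \o phi) = 'D_(L u) f \o phi); last first.
  by apply/funext => x; exact: derive_reparam.
by apply: IH; exact: Ck_on_derive.
Qed.

(** * Differentiability in the plane from continuous partial derivatives *)

Section Plane.
Context {R : realType}.

Lemma derive_mvt {V : normedModType R} (F : V -> R) (y v : V) :
  (forall s : R, 0 <= s <= 1 -> derivable F (s *: v + y) v) ->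
  exists c : R, 0 <= c <= 1 /\ F (v + y) - F y = 'D_v F (c *: v + y).
Proof.
move=> dF; pose G (s : R) := F (s *: v + y).
have dG (s : R) : s \in `[0, 1] -> is_derive s (1 : R) G ('D_v F (s *: v + y)).
  by rewrite in_itv/= => s01; apply/is_derive_line/derivableP/dF.
have cG : {within `[0, 1 : R], continuous G}.
  by apply: derivable_within_continuous => s /dG [].
have [c c01] := @MVT _ G (fun s => 'D_v F (s *: v + y)) 0 1 ltr01
  (fun s s01 => dG s (subset_itv_oo_cc s01)) cG.
rewrite /G scale1r scale0r add0r subr0 mulr1 => E.
by exists c; split=> //; move: (subset_itv_oo_cc c01); rewrite /= in_itv.
Qed.

Definition e0 : 'rV[R]_2 := delta_mx 0 0.
Definition e1 : 'rV[R]_2 := delta_mx 0 1.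

Lemma rV2E (h : 'rV[R]_2) : h = h 0 0 *: e0 + h 0 1 *: e1.
Proof.
rewrite {1}[h]matrix_sum_delta big_ord1 !big_ord_recl big_ord0 addr0.
by congr (_ + _); congr (h 0 _ *: delta_mx 0 _); apply: val_inj.
Qed.

Lemma ler_rV_norm n (h : 'rV[R]_n) j : `|h 0 j| <= `|h|.
Proof.
rewrite [leRHS]/Num.Def.normr/= mx_normrE.
exact: (le_bigmax _ (fun ij : 'I_1 * 'I_n => `|h ij.1 ij.2|) (0, j)).
Qed.

Lemma rV2_norm_le (h : 'rV[R]_2) (r : R) :
  `|h 0 0| <= r -> `|h 0 1| <= r -> `|h| <= r.
Proof.
move=> h0 h1; rewrite [leLHS]/Num.Def.normr/= mx_normrE bigmax_le//.
  exact: le_trans h0.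
move=> [i j] _ /=; rewrite ord1; case: j => -[|[|//]] jP.
  by rewrite (_ : Ordinal jP = 0)//; exact: val_inj.
by rewrite (_ : Ordinal jP = 1)//; exact: val_inj.
Qed.

Lemma differentiable_eps {V W : normedModType R} (f : V -> W)
    (L : {linear V -> W}) x : continuous L ->
  (forall e : R, 0 < e -> \forall h \near 0,
     `|f (h + x) - f x - L h| <= e * `|h|) -> differentiable f x.
Proof.
move=> cL fL; suff E : f \o shift x = cst (f x) + L +o_ 0 id.
  have dE := diff_unique cL E.
  by apply/diff_locallyP; rewrite dE.
apply/eqaddoP => e e0; near=> h.
rewrite (_ : (_ - _) h = f (h + x) - f x - L h); first by near: h; exact: fL.
by rewrite -addrA -opprD.
Unshelve. all: by end_near. Qed.

(** The increment is split into two steps parallel to the axes; the mean value theorem on each and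
    the continuity of the partial derivatives at [x] bound the error by [e * |h|]. *)
Lemma partials_differentiable (D : set 'rV[R]_2) (F : 'rV[R]_2 -> R) x :
  open D -> D x -> (forall y v, D y -> derivable F y v) ->
  (forall v, {for x, continuous ('D_v F)}) -> differentiable F x.
Proof.
move=> oD Dx dF cD.
pose l (h : 'rV[R]_2) : R := h 0 0 * 'D_e0 F x + h 0 1 * 'D_e1 F x.
have lin_l : linear l.
  by move=> a u w; rewrite /l !mxE /GRing.scale/=; ring.
pose lM := GRing.isLinear.Build _ _ _ _ _ lin_l.
pose L : {linear 'rV[R]_2 -> R} := HB.pack l lM.
have cL : continuous L.
  have cc j (b : R) : continuous (fun h : 'rV[R]_2 => h 0 j * b).
    by move=> h; exact: (cvgMr_tmp (@coord_continuous R 1 2 0 j h)).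
  move=> h; exact: (@cvgD _ R _ _ _ _ _ _ _ (cc _ _ h) (cc _ _ h)).
apply: (@differentiable_eps _ _ F L) => // e egt0.
have : \forall y \near x, [/\ D y, `|'D_e0 F x - 'D_e0 F y| <= e / 2 &
                              `|'D_e1 F x - 'D_e1 F y| <= e / 2].
  have e2 : 0 < e / 2 by rewrite divr_gt0.
  have /cvgrPdist_le/(_ _ e2) n0 := cD e0.
  have /cvgrPdist_le/(_ _ e2) n1 := cD e1.
  by apply: filterS3 (open_nbhs_nbhs (conj oD Dx)) n0 n1 => y; split.
move=> /nbhs_ballP[d /= d0 dP].
near=> h.
have hd : `|h| < d.
  near: h; apply: filterS (nbhsx_ballx (0 : 'rV[R]_2) d d0) => h.
  by rewrite -ball_normE /= sub0r normrN.
(* The norm of row vectors is the maximum norm, so every corner and intermediate point of the two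
   steps stays in the ball. *)
have bP (a b : R) : `|a| <= `|h| -> `|b| <= `|h| ->
   ball x d (a *: e0 + (b *: e1 + x)).
  move=> ah bh; rewrite -ball_normE /= addrA opprD addrCA subrr addr0 normrN.
  by apply: le_lt_trans hd; apply: rV2_norm_le; rewrite !mxE/= ?mulr1 ?mulr0 ?addr0 ?add0r.
have h0 := ler_rV_norm h 0; have h1 := ler_rV_norm h 1.
have sc (s a : R) : 0 <= s <= 1 -> `|a| <= `|h| -> `|s * a| <= `|h|.
  move=> /andP[s0 s1] ah; rewrite normrM (le_trans _ ah)// ger0_norm//.
  by rewrite ler_piMl.
have Z0 : (0 : R) *: e0 = 0 by rewrite scale0r.
have n0 : `|0 : R| <= `|h| by rewrite normr0.
have [c [c01 Ec]] : exists c : R, 0 <= c <= 1 /\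
    F (h 0 0 *: e0 + (h 0 1 *: e1 + x)) - F (h 0 1 *: e1 + x) =
    'D_(h 0 0 *: e0) F (c *: (h 0 0 *: e0) + (h 0 1 *: e1 + x)).
  apply: derive_mvt => s s01; apply: dF.
  by rewrite scalerA; have [] := dP _ (bP (s * h 0 0) (h 0 1) (sc _ _ s01 h0) h1).
have [c' [c'01 Ec']] : exists c : R, 0 <= c <= 1 /\
    F (h 0 1 *: e1 + x) - F x = 'D_(h 0 1 *: e1) F (c *: (h 0 1 *: e1) + x).
  apply: derive_mvt => s s01; apply: dF.
  by rewrite scalerA; have [] := dP _ (bP 0 (s * h 0 1) n0 (sc _ _ s01 h1));
     rewrite Z0 add0r.
have [_ A0 _] := dP _ (bP (c * h 0 0) (h 0 1) (sc _ _ c01 h0) h1).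
have [_ _ A1] := dP _ (bP 0 (c' * h 0 1) n0 (sc _ _ c'01 h1)).
have [D0 _ _] := dP _ (bP (c * h 0 0) (h 0 1) (sc _ _ c01 h0) h1).
have [D1 _ _] := dP _ (bP 0 (c' * h 0 1) n0 (sc _ _ c'01 h1)).
rewrite Z0 add0r in A1 D1.
rewrite !scalerA in Ec Ec'.
(* Each half of the error [e] pays for one of the two steps, which meet at the corner
   [h 0 1 *: e1 + x]. *)
have -> : F (h + x) - F x - L h =
    h 0 0 * ('D_e0 F (c * h 0 0 *: e0 + (h 0 1 *: e1 + x)) - 'D_e0 F x) +
    h 0 1 * ('D_e1 F (c' * h 0 1 *: e1 + x) - 'D_e1 F x).
  rewrite -[L h]/(l h).
  have -> : F (h + x) - F x =
      (F (h 0 0 *: e0 + (h 0 1 *: e1 + x)) - F (h 0 1 *: e1 + x)) +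
      (F (h 0 1 *: e1 + x) - F x).
    by rewrite subrKA addrA -rV2E.
  rewrite Ec Ec'.
  have [_ ->] := is_derive_scale (h 0 0) (derivableP (dF _ e0 D0)).
  have [_ ->] := is_derive_scale (h 0 1) (derivableP (dF _ e1 D1)).
  by rewrite /l /GRing.scale/=; ring.
rewrite (le_trans (ler_normD _ _))// !normrM.
rewrite [e in leRHS]splitr mulrDl.
rewrite lerD// mulrC ler_pM//; by rewrite distrC.
Unshelve. all: by end_near. Qed.

Lemma Ck_on_differentiable (D : set 'rV[R]_2) (F : 'rV[R]_2 -> R) x :
  open D -> Ck_on 1 D F -> D x -> differentiable F x.
Proof.
move=> oD kF Dx; apply: (partials_differentiable oD) => //.
  by move=> y v Dy; exact: Ck_on_derivable kF Dy.
move=> v; exact: (Ck_on_cts (Ck_on_derive v kF)).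
Qed.

Lemma derive_rV2 (F : 'rV[R]_2 -> R) x (v : 'rV[R]_2) : differentiable F x ->
  'D_v F x = v 0 0 * 'D_e0 F x + v 0 1 * 'D_e1 F x.
Proof.
by move=> dF; rewrite !deriveE// {1}[v]rV2E linearD !linearZ.
Qed.

Lemma is_derive_curve (D : set 'rV[R]_2) (F : 'rV[R]_2 -> R)
    (g : R -> 'rV[R]_2) (t : R) :
  open D -> Ck_on 1 D F -> D (g t) -> derivable g t 1 ->
  is_derive t (1 : R) (F \o g) ('D_('D_1 g t) F (g t)).
Proof.
move=> oD kF Dg /derivable1_diffP dg.
have dF := Ck_on_differentiable oD kF Dg.
split; first exact/diff_derivable/differentiable_comp.
rewrite deriveE; last exact: differentiable_comp.
by rewrite diff_comp// !deriveE.
Qed.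

End Plane.

(** * Primitives and linear differential equations on [[0, 1]] *)

Section RealCalculus.
Context {R : realType}.

Section Pointwise.
Context {V : normedModType R}.
Implicit Types (f g : V -> R) (x v : V).

Lemma is_derive_addf f g x v df dg : is_derive x v f df -> is_derive x v g dg ->
  is_derive x v (fun y => f y + g y) (df + dg).
Proof. by move=> fd gd; exact: (is_deriveD fd gd). Qed.

Lemma is_derive_oppf f x v df : is_derive x v f df ->
  is_derive x v (fun y => - f y) (- df).
Proof. by move=> fd; exact: (is_deriveN fd). Qed.

Lemma is_derive_mulf f g x v df dg : is_derive x v f df -> is_derive x v g dg ->
  is_derive x v (fun y => f y * g y) (f x * dg + g x * df).
Proof. by move=> fd gd; exact: (is_deriveM fd gd). Qed.

Lemma is_derive_invf f x v df : f x != 0 -> is_derive x v f df ->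
  is_derive x v (fun y => (f y)^-1) (- ((f x)^-1 * (f x)^-1) * df).
Proof.
move=> f0 [fd <-]; split; first exact: derivableV.
by rewrite deriveV// -exprVn.
Qed.

Lemma is_derive_expf f x v df : is_derive x v f df ->
  is_derive x v (fun y => expR (f y)) (expR (f x) * df).
Proof. by move=> fd; exact: (is_derive_comp fd (is_derive_expR (f x))). Qed.

Lemma is_derive_cosf f x v df : is_derive x v f df ->
  is_derive x v (fun y => cos (f y)) (- sin (f x) * df).
Proof. by move=> fd; exact: (is_derive_comp fd (is_derive_cos (f x))). Qed.

Lemma is_derive_sinf f x v df : is_derive x v f df ->
  is_derive x v (fun y => sin (f y)) (cos (f x) * df).
Proof. by move=> fd; exact: (is_derive_comp fd (is_derive_sin (f x))). Qed.

Lemma is_derive_cstf (c : R) x v : is_derive x v (fun=> c) 0.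
Proof. exact: is_derive_cst. Qed.

Lemma is_derive_eqf f x v (df df' : R) :
  is_derive x v f df -> df = df' -> is_derive x v f df'.
Proof. by move=> fd <-. Qed.

Lemma is_derive_unique f x v df dg :
  is_derive x v f df -> is_derive x v f dg -> df = dg.
Proof. by move=> [_ <-] [_ <-]. Qed.

End Pointwise.

End RealCalculus.

(* Type class resolution is kept out, so that the derivatives are those of the
   lemmas above. *)
Ltac derive_rules :=
  repeat first
  [ eassumption
  | exact: is_derive_cstf
  | notypeclasses refine (is_derive_oppf _)
  | notypeclasses refine (is_derive_addf _ _)
  | notypeclasses refine (is_derive_mulf _ _)
  | notypeclasses refine (is_derive_expf _)
  | notypeclasses refine (is_derive_cosf _)
  | notypeclasses refine (is_derive_sinf _)
  | notypeclasses refine (is_derive_invf _ _) ].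
Ltac derive_by tac :=
  notypeclasses refine (is_derive_eqf _ _); [derive_rules|cbv beta; tac].

Section Primitives.
Context {R : realType}.
Implicit Types (f u v p q P Q : R -> R).

Lemma derive0_constant f (r s : R) :
  (forall t : R, 0 <= t <= 1 -> is_derive t (1 : R) f 0) ->
  0 <= r <= 1 -> 0 <= s <= 1 -> f r = f s.
Proof.
move=> df.
wlog rs : r s / r <= s.
  by move=> H r01 s01; case/orP: (le_total r s) => h;
    [exact: H|apply/esym; exact: H].
move=> /andP[r0 r1] /andP[s0 s1].
have dF (t : R) : t \in `[r, s] -> is_derive t (1 : R) f 0.
  rewrite in_itv/= => /andP[rt ts]; apply: df.
  by rewrite (le_trans r0 rt) (le_trans ts s1).
have [|] := @MVT_segment _ f (fun=> 0) r s rs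
  (fun t ht => dF t (subset_itv_oo_cc ht)).
  by apply: derivable_within_continuous => t /dF[].
by move=> c _ /eqP; rewrite mul0r subr_eq0 => /eqP.
Qed.

Lemma primitive_unique P Q f (r s : R) :
  (forall t : R, 0 <= t <= 1 -> is_derive t (1 : R) P (f t)) ->
  (forall t : R, 0 <= t <= 1 -> is_derive t (1 : R) Q (f t)) ->
  0 <= r <= 1 -> 0 <= s <= 1 -> P s - P r = Q s - Q r.
Proof.
move=> dP dQ r01 s01.
have : P r - Q r = P s - Q s.
  apply: (@derive0_constant (fun t => P t - Q t)) => // t t01.
  have hP := dP _ t01; have hQ := dQ _ t01.
  derive_by ltac:(by rewrite subrr).
by move=> E; rewrite -[P s](subrK (Q s)) -E; ring.
Qed.

Lemma primitive_exists f : (forall t : R, 0 <= t <= 1 -> {for t, continuous f}) ->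
  exists P, (forall t : R, 0 <= t <= 1 -> is_derive t (1 : R) P (f t)) /\
    \int[lebesgue_measure]_(t in `[0, 1]) f t = P 1 - P 0.
Proof.
move=> cf.
(* The retraction of the line onto [0, 1]: composed with it, [f] becomes continuous everywhere
   without changing on [0, 1]. *)
pose cl (t : R) : R := Num.max 0 (Num.min t 1).
have cl01 (t : R) : 0 <= cl t <= 1.
  by rewrite /cl le_max lexx/= ge_max ler01/= ge_min lexx orbT.
have clE (t : R) : 0 <= t <= 1 -> cl t = t.
  by move=> /andP[t0 t1]; rewrite /cl min_l// max_r.
have ccl : continuous cl.
  rewrite (_ : cl = cst 0 \max (id \min cst 1))// => t.
  apply: continuous_max; first exact: cst_continuous.
  by apply: continuous_min; [exact: cvg_id|exact: cst_continuous].
pose ft := f \o cl.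
have cft : continuous ft.
  by move=> t; apply: continuous_comp; [exact: ccl|exact: cf].
have int_ft (a b : R) : lebesgue_measure.-integrable `[a, b] (EFin \o ft).
  apply: continuous_compact_integrable; first exact: segment_compact.
  exact: continuous_subspaceT.
(* Integrating from -1, inside [-1, 2], makes 0 and 1 interior points, so the derivatives there are
   two-sided. *)
exists (fun x => \int[lebesgue_measure]_(t in `[-1, x]) ft t); split.
  move=> t /[dup] t01 /andP[t0 t1].
  have t2 : t < 2 by lra.
  have tm1 : -1 < t by lra.
  have [dF FE] := continuous_FTC1_closed t2 (int_ft (-1) 2) tm1 (cft t).
  by split=> //; rewrite -derive1E FE /ft/= clE.
rewrite Rintegral_itvB ?bnd_simp //.
rewrite Rintegral_itv_obnd_cbnd; last first.
  apply: (integrableS _ _ _ (int_ft 0 1)) => //.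
  exact: subset_itv_oc_cc.
apply: eq_Rintegral => t; rewrite inE/= in_itv/= => t01.
by rewrite /ft/= clE.
Qed.

Lemma linear_ode P p u :
  (forall t : R, 0 <= t <= 1 -> is_derive t (1 : R) P (p t)) ->
  (forall t : R, 0 <= t <= 1 -> is_derive t (1 : R) u (u t * p t)) ->
  u 1 = u 0 * expR (P 1 - P 0).
Proof.
move=> dP du.
have E : u 0 * expR (- P 0) = u 1 * expR (- P 1).
  apply: (@derive0_constant (fun t => u t * expR (- P t)));
    rewrite ?lexx ?ler01// => t t01.
  have hP := dP _ t01; have hu := du _ t01.
  derive_by ltac:(by ring).
rewrite addrC expRD mulrA E -mulrA -expRD addNr expR0 mulr1//.
Qed.

(** The system is w' = w (p + i q) with w = u + i v. Below, [A] and [B] are the real and imaginary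
    parts of w exp (- (P - P 0) - i (Q - Q 0)), which is constant. *)
Lemma complex_linear_ode P Q p q u v :
  (forall t : R, 0 <= t <= 1 -> is_derive t (1 : R) P (p t)) ->
  (forall t : R, 0 <= t <= 1 -> is_derive t (1 : R) Q (q t)) ->
  (forall t : R, 0 <= t <= 1 ->
     is_derive t (1 : R) u (u t * p t - v t * q t)) ->
  (forall t : R, 0 <= t <= 1 ->
     is_derive t (1 : R) v (u t * q t + v t * p t)) ->
  u 1 +i* v 1 = (u 0 +i* v 0) * cexp ((P 1 - P 0) +i* (Q 1 - Q 0)).
Proof.
move=> dP dQ du dv.
pose A t := expR (P 0 - P t) * (u t * cos (Q t - Q 0) + v t * sin (Q t - Q 0)).
pose B t := expR (P 0 - P t) * (v t * cos (Q t - Q 0) - u t * sin (Q t - Q 0)).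
have r0 : 0 <= (0 : R) <= 1 by rewrite lexx ler01.
have r1 : 0 <= (1 : R) <= 1 by rewrite lexx ler01.
have EA : A 0 = A 1.
  apply: derive0_constant => // t t01.
  have hP := dP _ t01; have hQ := dQ _ t01.
  have hu := du _ t01; have hv := dv _ t01.
  derive_by ltac:(by ring).
have EB : B 0 = B 1.
  apply: derive0_constant => // t t01.
  have hP := dP _ t01; have hQ := dQ _ t01.
  have hu := du _ t01; have hv := dv _ t01.
  derive_by ltac:(by ring).
move: EA EB; rewrite /A /B !subrr expR0 cos0 sin0 !mulr1 !mulr0 !mul1r subr0 addr0.
move=> -> ->; rewrite /cexp /=.
have eP : expR (P 0 - P 1) * expR (P 1 - P 0) = 1.
  by rewrite -expRD subrKA subrr expR0.
have cs := cos2Dsin2 (Q 1 - Q 0).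
set e := expR (P 0 - P 1) in eP *; set e' := expR (P 1 - P 0) in eP *.
set c := cos _ in cs *; set s := sin _ in cs *.
apply/eqP; rewrite eq_complex/=; apply/andP; split; apply/eqP.
  transitivity (u 1 * (e * e') * (c ^+ 2 + s ^+ 2)); last by ring.
  by rewrite eP cs !mulr1.
transitivity (v 1 * (e * e') * (c ^+ 2 + s ^+ 2)); last by ring.
by rewrite eP cs !mulr1.
Qed.

End Primitives.

(** * Functions of one variable that are C^1 at a point *)

Section C1.
Context {R : realType}.
Implicit Types u v : R -> R.

(** Derivability near [t], and not only at [t], lets the differentiation rules hold on a
    neighbourhood, so that continuity of the derivative at [t] passes to sums, products and
    inverses. *)
Definition C1at u (t : R) : Prop :=
  (\forall s \near t, derivable u s 1) /\ {for t, continuous (derive1 u)}.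

Lemma C1at_is_derive u t : C1at u t -> is_derive t (1 : R) u (derive1 u t).
Proof.
by move=> [/nbhs_singleton ud _]; rewrite derive1E; exact: derivableP.
Qed.

Lemma C1at_cts u t : C1at u t -> {for t, continuous u}.
Proof.
by move=> [/nbhs_singleton/derivable1_diffP ud _]; exact: differentiable_continuous.
Qed.

Lemma C1at_intro u (u' : R -> R) t : (\forall s \near t, is_derive s (1 : R) u (u' s)) ->
  {for t, continuous u'} -> C1at u t.
Proof.
move=> du cu'; split; first by apply: filterS du => s [].
have E : \forall s \near t, u' s = derive1 u s.
  by apply: filterS du => s [_ <-]; rewrite derive1E.
rewrite /prop_for /continuous_at -(nbhs_singleton E).
by apply: cvg_trans cu'; exact: near_eq_cvg.
Qed.

Lemma C1at_near_is_derive u t : C1at u t ->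
  \forall s \near t, is_derive s (1 : R) u (derive1 u s).
Proof.
by move=> [ud _]; apply: filterS ud => s ud; rewrite derive1E; exact: derivableP.
Qed.

Lemma C1at_cst (c : R) t : C1at (fun=> c) t.
Proof.
apply: (@C1at_intro _ (fun=> 0)); last exact: cst_continuous.
by near=> s; exact: is_derive_cstf.
Unshelve. all: by end_near. Qed.

Lemma C1atD u v t : C1at u t -> C1at v t -> C1at (fun s => u s + v s) t.
Proof.
move=> cu cv; apply: (@C1at_intro _ (fun s => derive1 u s + derive1 v s)).
  apply: filterS2 (C1at_near_is_derive cu) (C1at_near_is_derive cv) => s.
  exact: is_derive_addf.
by apply: (@cvgD _ R); [exact: cu.2|exact: cv.2].
Qed.

Lemma C1atM u v t : C1at u t -> C1at v t -> C1at (fun s => u s * v s) t.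
Proof.
move=> cu cv; apply: (@C1at_intro _ (fun s => u s * derive1 v s + v s * derive1 u s)).
  apply: filterS2 (C1at_near_is_derive cu) (C1at_near_is_derive cv) => s.
  exact: is_derive_mulf.
have [ctu ctv] := (C1at_cts cu, C1at_cts cv).
by apply: (@cvgD _ R); apply: cvgM => //; [exact: cv.2|exact: cu.2].
Qed.

Lemma C1atN u t : C1at u t -> C1at (fun s => - u s) t.
Proof.
move=> cu; rewrite (_ : (fun s => - u s) = (fun s => -1 * u s)).
  by apply: C1atM => //; exact: C1at_cst.
by apply/funext => s; rewrite mulN1r.
Qed.

Lemma C1atV u t : u t != 0 -> C1at u t -> C1at (fun s => (u s)^-1) t.
Proof.
move=> u0 cu; have ctu := C1at_cts cu.
have nu0 : \forall s \near t, u s != 0.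
  have n0 : nbhs (u t) [set y : R | y != 0].
    by apply: open_nbhs_nbhs; split=> //; exact: open_neq.
  exact: (ctu _ n0).
apply: (@C1at_intro _ (fun s => - ((u s)^-1 * (u s)^-1) * derive1 u s)).
  apply: filterS2 nu0 (C1at_near_is_derive cu) => s.
  exact: is_derive_invf.
have cV : {for t, continuous (fun s => (u s)^-1)} by apply: cvgV.
exact: (cvgM (@cvgN _ R _ _ _ _ _ (cvgM cV cV)) cu.2).
Qed.

End C1.

(** * Line integrals along piecewise smooth paths *)

Lemma continuous_sum {R : realType} {T : topologicalType} n (f : 'I_n -> T -> R)
    (t : T) : (forall k, {for t, continuous (f k)}) ->
  {for t, continuous (fun s => \sum_(k < n) f k s)}.
Proof.
elim: n f => [|n IH] f cf.
  rewrite (_ : (fun s => _) = (fun=> 0)); first exact: cst_continuous.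
  by apply/funext => s; rewrite big_ord0.
rewrite (_ : (fun s => _) =
    (fun s => f ord0 s + \sum_(k < n) f (lift ord0 k) s)).
  exact: (@cvgD _ R _ _ _ _ _ _ _ (cf ord0) (IH (fun k => f (lift ord0 k))
    (fun k => cf (lift ord0 k)))).
by apply/funext => s; rewrite big_ord_recl.
Qed.

Section Arcs.
Context {R : realType} {S : topologicalType} (M : oriented_surface R S).

Lemma chart_image i p : dom M i p -> (chart M i @` dom M i) (chart M i p).
Proof. by move=> ip; exists p. Qed.

(** Near [t] the curve stays in one chart domain, where [f \o a] is
    [(f \o param M i) \o (chart M i \o a)] and the planar chain rule applies. The formula is given
    in every chart around [a t], so that several functions can be compared in the same chart. *)
Lemma smooth_along (U : set R) (a : R -> S) (f : S -> R) (t : R) :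
  open U -> smooth_curve M U a -> smooth_map M f -> U t ->
  C1at (f \o a) t /\
  forall i, dom M i (a t) -> is_derive t (1 : R) (f \o a)
    ('D_('D_1 (chart M i \o a) t) (f \o param M i) (chart M i (a t))).
Proof.
move=> oU [ca sa] sf Ut.
have Hi i : dom M i (a t) ->
    is_derive t (1 : R) (f \o a)
      ('D_('D_1 (chart M i \o a) t) (f \o param M i) (chart M i (a t))) /\
    C1at (f \o a) t.
  move=> iat.
  pose g := chart M i \o a; pose F := f \o param M i.
  pose D := chart M i @` dom M i; pose O := U `&` a @^-1` dom M i.
  have oD : open D := @chart_open R S M i.
  have oO : open O.
    rewrite openE => s [Us is_]; apply: filterI.
      exact: open_nbhs_nbhs.
    by apply: (ca s Us); apply: open_nbhs_nbhs; split=> //; exact: dom_open.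
  have kF : Ck_on 1 D F := sf i 1%N.
  have kg : Ck_on 1 O g := sa i 1%N.
  have Og s : O s -> D (g s) by move=> [_ ias]; exact: chart_image.
  have dg s : O s -> is_derive s (1 : R) (f \o a) ('D_('D_1 g s) F (g s)).
    move=> Os; apply: (@near_eq_is_derive _ _ _ (F \o g)).
      apply: filterS (open_nbhs_nbhs (conj oO Os)) => r [_ iar].
      by rewrite /F /g /= chartK.
    apply: (is_derive_curve oD kF (Og _ Os)).
    exact: Ck_on_derivable kg Os.
  have Ot : O t by [].
  split; first exact: dg.
  pose w s := ('D_1 g s) 0 0 * 'D_e0 F (g s) + ('D_1 g s) 0 1 * 'D_e1 F (g s).
  apply: (@C1at_intro _ _ w).
    apply: filterS (open_nbhs_nbhs (conj oO Ot)) => s Os.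
    by have := dg s Os; rewrite derive_rV2//; exact: Ck_on_differentiable oD kF (Og _ Os).
  have cg : {for t, continuous g} := Ck_on_cts kg Ot.
  have kdg : Ck_on 0 O ('D_1 g) by exact: Ck_on_derive kg.
  have cdg : {for t, continuous ('D_1 g)} := Ck_on_cts kdg Ot.
  have cco j : {for t, continuous (fun s => ('D_1 g s) 0 j)}.
    apply: (@continuous_comp _ _ _ ('D_1 g) (fun m : 'rV[R]_2 => m 0 j)) => //.
    exact: coord_continuous.
  have cF e : {for t, continuous (fun s => 'D_e F (g s))}.
    apply: (@continuous_comp _ _ _ g ('D_e F)) => //.
    exact: Ck_on_cts (Ck_on_derive e kF) (Og _ Ot).
  exact: (@cvgD _ R _ _ _ _ _ _ _ (cvgM (cco 0) (cF e0)) (cvgM (cco 1) (cF e1))).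
have [i iat] := @surf_cover R S M (a t).
by split=> [|j jat]; [exact: (Hi i iat).2|exact: (Hi j jat).1].
Qed.

Lemma smooth_arc_C1 (a : R -> S) (f : S -> R) (t : R) :
  smooth_arc M a -> smooth_map M f -> 0 <= t <= 1 -> C1at (f \o a) t.
Proof.
move=> [U [oU sU ca]] sf t01; apply: (smooth_along oU ca sf _).1.
by apply: sU; rewrite /= in_itv.
Qed.

Lemma affine01 (r s t : R) : 0 <= r <= 1 -> 0 <= s <= 1 -> 0 <= t <= 1 ->
  0 <= t * (s - r) + r <= 1.
Proof. by move=> /andP[? ?] /andP[? ?] /andP[? ?]; apply/andP; split; nra. Qed.

Lemma continuous_affine {V : normedModType R} (v x : V) :
  continuous (fun t : R => t *: v + x).
Proof.
move=> t; apply: (@cvgD _ V); last exact: cvg_cst.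
by apply: cvgZr_tmp; exact: cvg_id.
Qed.

(** Since [r] and [s] are not ordered, this yields subarcs as well as the reversed arc ([r = 1],
    [s = 0]). *)
Lemma smooth_arc_affine (a : R -> S) (r s : R) :
  smooth_arc M a -> 0 <= r <= 1 -> 0 <= s <= 1 ->
  smooth_arc M (fun t => a (t * (s - r) + r)).
Proof.
move=> [U [oU sU [ca sa]]] r01 s01.
pose phi (t : R) : R := t * (s - r) + r.
have cphi : continuous phi by exact: (@continuous_affine R (s - r) r).
exists (phi @^-1` U); split.
- by apply: open_comp => // t _; exact: cphi.
- move=> t; rewrite /= in_itv/= => t01; apply: sU.
  by rewrite /= in_itv/=; exact: affine01.
- split=> [t Ut|i k].
    by apply: (@continuous_comp _ _ _ phi a); [exact: cphi|exact: ca].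
  apply: (@Ck_on_affine _ _ _ _ _ _ (chart M i \o a) phi (fun u => u * (s - r))
    _ _ cphi _ (sa i k)).
    by move=> h u x; rewrite /phi /GRing.scale/=; ring.
  by move=> t [].
Qed.

(** Read in another chart, the segment is a transition map precomposed with an affine map. *)
Lemma smooth_arc_line i (x v : 'rV[R]_2) :
  (forall t : R, 0 <= t <= 1 -> (chart M i @` dom M i) (t *: v + x)) ->
  smooth_arc M (fun t => param M i (t *: v + x)).
Proof.
move=> seg; pose phi (t : R) := t *: v + x.
have cphi : continuous phi by exact: continuous_affine.
exists (phi @^-1` (chart M i @` dom M i)); split.
- by apply: open_comp => [t _|]; [exact: cphi|exact: chart_open].
- by move=> t; rewrite /= in_itv/=; exact: seg.
- split=> [t Ut|j k].
    apply: (@continuous_comp _ _ _ phi (param M i)); first exact: cphi.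
    exact: param_cts.
  apply: (@Ck_on_affine _ _ _ _ _ _ (chart M j \o param M i) phi (fun u : R => u *: v)
    _ _ cphi _ (@transition_smooth R S M i j k)).
    by move=> h u y; rewrite /phi scalerDl addrA scalerA.
  move=> t [[p ip pE] jt]; exists p => //; split=> //.
  by move: jt; rewrite /= -/(phi t) -pE chartK.
Qed.

Section LineIntegral.
Variables x y : S -> 'rV[R]_3.
Hypothesis sx : forall k, smooth_map M (fun p => x p 0 k).
Hypothesis sy : forall k, smooth_map M (fun p => y p 0 k).
Hypothesis xy1 : forall p, dot (x p) (y p) != 1.

(* The 1-form <dx, y> / (1 - <x, y>) along the arc [a]. *)
Definition arc_form (a : R -> S) (t : R) : R :=
  (\sum_(k < 3) derive1 (fun s => x (a s) 0 k) t * y (a t) 0 k) /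
  (1 - dot (x (a t)) (y (a t))).

Definition arc_int a : R := \int[lebesgue_measure]_(t in `[0, 1]) arc_form a t.

Definition path_int (c : seq (R -> S)) : R := \sum_(a <- c) arc_int a.

Lemma dot_neq1 p : 1 - dot (x p) (y p) != 0.
Proof. by rewrite subr_eq0 eq_sym xy1. Qed.

Lemma arc_form_continuous (a : R -> S) (t : R) :
  smooth_arc M a -> 0 <= t <= 1 -> {for t, continuous (arc_form a)}.
Proof.
move=> sa t01.
have cx k := smooth_arc_C1 sa (sx k) t01.
have cy k := C1at_cts (smooth_arc_C1 sa (sy k) t01).
have cxt k := C1at_cts (cx k).
have c1 : {for t, continuous (fun s => \sum_(k < 3)
    derive1 (fun s => x (a s) 0 k) s * y (a s) 0 k)}.
  by apply: continuous_sum => k; exact: (cvgM (cx k).2 (cy k)).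
have c2 : {for t, continuous (fun s => dot (x (a s)) (y (a s)))}.
  by apply: continuous_sum => k; exact: (cvgM (cxt k) (cy k)).
have c3 : {for t, continuous (fun s => 1 - dot (x (a s)) (y (a s)))}.
  exact: (@cvgB _ R _ _ _ _ _ _ _ (cvg_cst _) c2).
exact: (cvgM c1 (cvgV (dot_neq1 _) c3)).
Qed.

Lemma arc_primitive a : smooth_arc M a ->
  exists P : R -> R,
    (forall t : R, 0 <= t <= 1 -> is_derive t (1 : R) P (arc_form a t)) /\
    arc_int a = P 1 - P 0.
Proof.
by move=> sa; apply: primitive_exists => t t01; exact: arc_form_continuous.
Qed.

(** The substitution is made on primitives and not on integrals: [P \o phi] is a primitive of the
    form along the reparametrized arc, whichever of [r] and [s] is larger. *)
Lemma arc_int_affine a P (r s : R) : smooth_arc M a ->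
  (forall t : R, 0 <= t <= 1 -> is_derive t (1 : R) P (arc_form a t)) ->
  0 <= r <= 1 -> 0 <= s <= 1 ->
  arc_int (fun t => a (t * (s - r) + r)) = P s - P r.
Proof.
move=> sa dP r01 s01.
pose phi (t : R) : R := t * (s - r) + r.
have dphi t : is_derive t (1 : R) phi (s - r).
  apply: (@is_derive_eqf _ _ _ _ _ (t * 0 + (s - r) * 1 + 0)); last by ring.
  exact: (is_derive_addf (is_derive_mulf (is_derive_id _ _) (is_derive_cst _ _ _))
    (is_derive_cst _ _ _)).
have sb := smooth_arc_affine sa r01 s01.
have [Q [dQ ->]] := arc_primitive sb.
have dPphi (t : R) : 0 <= t <= 1 -> is_derive t (1 : R) (P \o phi)
    (arc_form (fun t => a (t * (s - r) + r)) t).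
  move=> t01; have p01 := affine01 r01 s01 t01.
  apply: (@is_derive_eqf _ _ _ _ _ (arc_form a (phi t) * (s - r))).
    exact: (is_derive_comp (dphi t) (dP _ p01)).
  rewrite /arc_form -/(phi t) mulrAC; congr (_ / _).
  rewrite mulr_suml; apply: eq_bigr => k _.
  have dk := C1at_is_derive (smooth_arc_C1 sa (sx k) p01).
  have /@derive_val := is_derive_comp (dphi t) dk.
  by rewrite -derive1E => ->; rewrite mulrAC.
have -> := primitive_unique dQ dPphi (r := 0) (s := 1).
- by rewrite /= /phi mul1r mul0r subrK add0r.
- by rewrite lexx ler01.
- by rewrite ler01 lexx.
Qed.

Lemma arc_int_rev a : smooth_arc M a ->
  smooth_arc M (fun t => a (1 - t)) /\ arc_int (fun t => a (1 - t)) = - arc_int a.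
Proof.
move=> sa; have [P [dP ->]] := arc_primitive sa.
have -> : (fun t => a (1 - t)) = (fun t => a (t * (0 - 1) + 1)).
  by apply/funext => t; congr a; ring.
have r0 : 0 <= (0 : R) <= 1 by rewrite lexx ler01.
have r1 : 0 <= (1 : R) <= 1 by rewrite lexx ler01.
by rewrite (arc_int_affine sa dP)// opprB; split=> //; exact: smooth_arc_affine.
Qed.

Lemma is_path_cat c c' p q r :
  is_path M p c q -> is_path M q c' r -> is_path M p (c ++ c') r.
Proof.
elim: c p => [|a c IH] p /=; first by move=> ->.
by move=> [sa a0 cq] qr; split=> //; exact: IH cq qr.
Qed.

Lemma path_int_cat c c' : path_int (c ++ c') = path_int c + path_int c'.
Proof. by rewrite /path_int big_cat. Qed.

Lemma is_path_rev c p q : is_path M p c q ->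
  exists c', is_path M q c' p /\ path_int c' = - path_int c.
Proof.
elim: c p => [|a c IH] p /=.
  by move=> ->; exists [::]; rewrite /path_int big_nil oppr0.
move=> [sa a0 /IH[c' [pc' ic']]].
have [sr ir] := arc_int_rev sa.
exists (c' ++ [:: (fun t => a (1 - t))]); split.
  apply: is_path_cat pc' _ => /=.
  by rewrite subr0 subrr; split.
rewrite path_int_cat ic' /path_int big_cons big_nil ir addr0.
by rewrite [in RHS]big_cons opprD addrC.
Qed.

(** The surface may be disconnected, so each class of points joined by paths gets its own base
    point. [rep] picks it from the set [cls p] alone, and points joined by a path, having equal
    classes, share it. *)
Lemma path_primitive :
  (forall p c, is_path M p c p -> path_int c = 0) ->
  exists I : S -> R, forall p c q, is_path M p c q -> I q - I p = path_int c.
Proof.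
move=> loops.
have [[p0 _]|S0] := pselect (exists p : S, True); last first.
  by exists (fun=> 0) => p; case: S0; exists p.
pose cls p := [set q | exists c, is_path M q c p].
pose rep p := xget p0 (cls p).
have clsxx p : cls p p by exists [::].
have repP p : cls p (rep p) by exact: (xgetPex p0 (ex_intro _ p (clsxx p))).
have /choice[C CP] : forall p, exists c, is_path M (rep p) c p by [].
exists (path_int \o C) => p c q pq.
have [c' [qp ic']] := is_path_rev pq.
have eqcls : cls p = cls q.
  by apply/seteqP; split=> r [d rd]; [exists (d ++ c)|exists (d ++ c')];
    exact: is_path_cat rd _.
have rE : rep q = rep p by rewrite /rep eqcls.
have CQ := CP q; rewrite rE in CQ.
have [d [dP dI]] := is_path_rev CQ.
have := loops _ _ (is_path_cat (is_path_cat (CP p) pq) dP).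
rewrite !path_int_cat dI /= => /eqP; rewrite subr_eq0 => /eqP <-.
by rewrite addrC addKr.
Qed.

Section Primitive.
Variable I : S -> R.
Hypothesis IP : forall p c q, is_path M p c q -> I q - I p = path_int c.

(** [IP] is applied to the initial subarcs of [a]. It determines [I \o a] only on [0, 1], hence the
    restriction to interior parameters. *)
Lemma primitive_along_arc a (t : R) : smooth_arc M a -> 0 < t < 1 ->
  is_derive t (1 : R) (I \o a) (arc_form a t).
Proof.
move=> sa /andP[t0 t1]; have [P [dP _]] := arc_primitive sa.
have r0 : 0 <= (0 : R) <= 1 by rewrite lexx ler01.
have E (s : R) : 0 <= s <= 1 -> P s + (I (a 0) - P 0) = (I \o a) s.
  move=> s01.
  have pas : is_path M (a 0) [:: fun t => a (t * (s - 0) + 0)] (a s).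
    rewrite /= mul0r mul1r subr0 !addr0; split=> //.
    by have := smooth_arc_affine sa r0 s01; rewrite subr0.
  have := IP pas; rewrite /path_int big_seq1 (arc_int_affine sa dP r0 s01).
  by move=> /eqP; rewrite subr_eq => /eqP /= ->; ring.
apply: (@near_eq_is_derive _ _ _ (fun s => P s + (I (a 0) - P 0))).
  have t01 : t \in `]0, 1[ by rewrite in_itv/= t0 t1.
  apply: filterS (near_in_itvoo t01) => s /subset_itv_oo_cc s01.
  by apply: E; move: s01; rewrite in_itv.
apply: (@is_derive_eqf _ _ _ _ _ (arc_form a t + 0)); last by rewrite addr0.
apply: is_derive_addf (is_derive_cst _ _ _).
by apply: dP; rewrite !ltW.
Qed.

(** The 1-form of [arc_form] read in the chart [i], at the point [z] and on the vector [v]. *)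
Definition chart_form i (v z : 'rV[R]_2) : R :=
  (\sum_(k < 3) 'D_v (fun z => x (param M i z) 0 k) z * y (param M i z) 0 k) /
  (1 - dot (x (param M i z)) (y (param M i z))).

Lemma primitive_in_chart i z v : (chart M i @` dom M i) z ->
  is_derive z v (I \o param M i) (chart_form i v z).
Proof.
move=> Uz; set U := chart M i @` dom M i in Uz.
have oU : open U := @chart_open R S M i.
have : nbhs (0 : R) ((fun s : R => s *: v + z) @^-1` U).
  apply: (@continuous_affine _ v z); rewrite scale0r add0r.
  exact: open_nbhs_nbhs.
move=> /nbhs_ballP[e /= e0 eP].
have e20 : 0 < e / 2 by rewrite divr_gt0.
(* The segment is centred at [z], which it meets at the interior parameter 1/2. It has velocity
   [e *: v], whence the factor [e^-1] further on. *)
have seg (t : R) : 0 <= t <= 1 -> U (t *: (e *: v) + (z - (e / 2) *: v)).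
  move=> /andP[t0 t1].
  have -> : t *: (e *: v) + (z - (e / 2) *: v) = (t * e - e / 2) *: v + z.
    by rewrite scalerA scalerBl addrCA addrC.
  apply: eP; rewrite -ball_normE/= sub0r normrN ltr_norml; apply/andP.
  by split; nra.
have sa := smooth_arc_line seg.
have half : 0 < (2^-1 : R) < 1 by rewrite invr_gt0 ltr0n invf_lt1// ltr1n.
have E : 2^-1 *: (e *: v) + (z - (e / 2) *: v) = z.
  by rewrite scalerA mulrC addrCA subrr addr0.
have dI := (@is_derive_line _ _ _ (I \o param M i) (z - (e / 2) *: v) (e *: v)
  2^-1 _).1 (primitive_along_arc sa half).
rewrite E in dI.
have -> : chart_form i v z = e^-1 *: arc_form (fun t => param M i (t *: (e *: v) +
    (z - (e / 2) *: v))) 2^-1.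
  rewrite /arc_form /chart_form E /GRing.scale /= mulrA mulr_sumr.
  congr (_ / _); apply: eq_bigr => k _.
  have kF : Ck_on 1 U (fun z => x (param M i z) 0 k) := sx k i 1%N.
  have dF := Ck_on_is_derive v kF Uz.
  have eF := is_derive_scale e dF; rewrite -{1}E in eF.
  have [_] := (is_derive_line _ _ _ _ _).2 eF.
  by rewrite -derive1E => ->; rewrite /GRing.scale/= mulrA mulKf// gt_eqF.
rewrite -[v in is_derive _ v](scalerK (lt0r_neq0 e0)).
exact: is_derive_scale.
Qed.

Lemma primitive_smooth : smooth_map M I.
Proof.
move=> i; set U := chart M i @` dom M i.
have oU : open U := @chart_open R S M i.
have kx k n : Ck_on n U (fun z => x (param M i z) 0 k) := sx k i n.
have ky k n : Ck_on n U (fun z => y (param M i z) 0 k) := sy k i n.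
have kform v n : Ck_on n U (chart_form i v).
  apply: Ck_onM => //.
    apply: Ck_on_sum => // k.
    exact: Ck_onM oU (Ck_on_derive v (kx k n.+1)) (ky k n).
  apply: Ck_onV => //; first by move=> z _; exact: dot_neq1.
  apply: Ck_onD => //; first exact: Ck_on_cst.
  apply: Ck_onN => //; apply: Ck_on_sum => // k.
  exact: Ck_onM oU (kx k n) (ky k n).
have dI v z : U z -> is_derive z v (I \o param M i) (chart_form i v z).
  exact: primitive_in_chart.
(* Existence of directional derivatives does not give continuity; here they equal the continuous
   functions [chart_form], so [I] is even differentiable in the chart. *)
have cI z : U z -> {for z, continuous (I \o param M i)}.
  move=> Uz; apply: differentiable_continuous.
  apply: (partials_differentiable oU Uz) => [w v Uw|v].
    by have [] := dI v w Uw.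
  have E : \forall w \near z, chart_form i v w = 'D_v (I \o param M i) w.
    apply: filterS (open_nbhs_nbhs (conj oU Uz)) => w Uw.
    by have [_ ->] := dI v w Uw.
  rewrite /prop_for /continuous_at -(nbhs_singleton E).
  have cw : {for z, continuous (chart_form i v)} := Ck_on_cts (kform v 0%N) Uz.
  exact (cvg_trans (near_eq_cvg E) cw).
case=> [|n]; first by split.
exact: (Ck_on_intro oU cI dI).
Qed.

End Primitive.

End LineIntegral.

End Arcs.

(** * The sphere in stereographic coordinates *)

Local Notation j0 := (inord 0 : 'I_3).
Local Notation j1 := (inord 1 : 'I_3).
Local Notation j2 := (inord 2 : 'I_3).

Section SphereAlgebra.
Context {R : realType}.
Implicit Types (u v n : 'rV[R]_3) (z : riemann_sphere R) (a b w : R[i]).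

Lemma ord3P (P : 'I_3 -> Prop) : P j0 -> P j1 -> P j2 -> forall k, P k.
Proof.
move=> h0 h1 h2 [[|[|[|//]]] lk].
- by rewrite (_ : Ordinal lk = j0)//; apply: val_inj; rewrite /= inordK.
- by rewrite (_ : Ordinal lk = j1)//; apply: val_inj; rewrite /= inordK.
- by rewrite (_ : Ordinal lk = j2)//; apply: val_inj; rewrite /= inordK.
Qed.

Lemma sum3E (f : 'I_3 -> R) : \sum_(k < 3) f k = f j0 + f j1 + f j2.
Proof.
rewrite !big_ord_recl big_ord0 addr0 addrA.
by congr (f _ + f _ + f _); apply: val_inj; rewrite /= inordK.
Qed.

Lemma dotE u v : dot u v = u 0 j0 * v 0 j0 + u 0 j1 * v 0 j1 + u 0 j2 * v 0 j2.
Proof. by rewrite /dot sum3E. Qed.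

Lemma vec3E (x y z : R) : (vec3 x y z 0 j0 = x) * (vec3 x y z 0 j1 = y) *
  (vec3 x y z 0 j2 = z).
Proof. by rewrite !mxE !inordK. Qed.

Lemma rV3P u v : u 0 j0 = v 0 j0 -> u 0 j1 = v 0 j1 -> u 0 j2 = v 0 j2 -> u = v.
Proof. by move=> h0 h1 h2; apply/rowP; exact: ord3P. Qed.

Lemma normc2E w : normc w ^+ 2 = complex.Re w ^+ 2 + complex.Im w ^+ 2.
Proof. by case: w => x y /=; rewrite sqr_sqrtr// addr_ge0// sqr_ge0. Qed.

Lemma sqrt_sumsqK (x y : R) : Num.sqrt (x ^+ 2 + y ^+ 2) ^+ 2 = x ^+ 2 + y ^+ 2.
Proof. by rewrite sqr_sqrtr// addr_ge0// sqr_ge0. Qed.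

Lemma normc2_gt0 (x : R) : 0 <= x -> 1 + x != 0.
Proof. by move=> x0; rewrite gt_eqF// ltr_pwDl. Qed.

Lemma den_neq0 (x y : R) : 1 + (x ^+ 2 + y ^+ 2) != 0.
Proof. by apply: normc2_gt0; rewrite addr_ge0// sqr_ge0. Qed.

Lemma stereo_inv_unit z : dot (stereo_inv z) (stereo_inv z) = 1.
Proof.
rewrite dotE; case: z => [[x y]|] /=; last by rewrite !vec3E; ring.
rewrite sqrt_sumsqK !mxE !inordK//=.
by field; exact: den_neq0.
Qed.

Lemma stereo_inv2 z : stereo_inv z 0 j2 = 1 <-> z = None.
Proof.
split; last by move=> ->; rewrite /= vec3E.
case: z => [[x y]|]//= /eqP; rewrite sqrt_sumsqK mxE vec3E.
have d0 := den_neq0 x y.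
rewrite -(inj_eq (mulfI d0)) mulVKf// mulr1 => /eqP E; exfalso.
have /eqP : 2 = 0 :> R by lra.
by rewrite pnatr_eq0.
Qed.

Lemma stereo_inv2_neq z : z <> None -> 1 - stereo_inv z 0 j2 != 0.
Proof.
move=> zN; rewrite subr_eq0 eq_sym; apply/negP => /eqP.
by move=> /stereo_inv2.
Qed.

(** Also true at infinity, where the numerators and the default value of [affine] are 0; functions
    of a parameter can thus be rewritten without a case distinction. *)
Lemma affineE z : affine z =
  (stereo_inv z 0 j0 / (1 - stereo_inv z 0 j2)) +i*
  (stereo_inv z 0 j1 / (1 - stereo_inv z 0 j2)).
Proof.
case: z => [[x y]|] /=; last by rewrite !vec3E !mul0r.
rewrite sqrt_sumsqK !mxE !inordK//=.
have d0 := den_neq0 x y.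
have E : 1 - (1 + (x ^+ 2 + y ^+ 2))^-1 * (x ^+ 2 + y ^+ 2 - 1) =
    2 / (1 + (x ^+ 2 + y ^+ 2)) by field.
by rewrite E; congr (_ +i* _); field; rewrite d0.
Qed.

Lemma stereoK n : dot n n = 1 -> stereo_inv (stereo n) = n.
Proof.
rewrite dotE /stereo => n1.
set x := n 0 j0 in n1 *; set y := n 0 j1 in n1 *; set t := n 0 j2 in n1 *.
case: eqP => t1.
  have /eqP : x ^+ 2 + y ^+ 2 = 0 by move: n1; rewrite t1; lra.
  rewrite paddr_eq0 ?sqr_ge0// !sqrf_eq0 => /andP[/eqP x0 /eqP y0].
  by apply: rV3P => /=; rewrite vec3E.
have d0 : 1 - t != 0 by rewrite subr_eq0 eq_sym; exact/eqP.
have E : 1 + ((x / (1 - t)) ^+ 2 + (y / (1 - t)) ^+ 2) = 2 / (1 - t).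
  have -> : 1 + ((x / (1 - t)) ^+ 2 + (y / (1 - t)) ^+ 2) =
     ((1 - t) ^+ 2 + (x * x + y * y)) / (1 - t) ^+ 2 by field.
  rewrite (_ : x * x + y * y = 1 - t * t); last by lra.
  by field.
have E' : (x / (1 - t)) ^+ 2 + (y / (1 - t)) ^+ 2 - 1 = 2 * t / (1 - t).
  have -> : (x / (1 - t)) ^+ 2 + (y / (1 - t)) ^+ 2 = 2 / (1 - t) - 1.
    by rewrite -E; ring.
  by field.
by apply: rV3P; rewrite /= sqrt_sumsqK E E' mxE vec3E -?/x -?/y -?/t; field.
Qed.

Lemma stereo_invK z : stereo (stereo_inv z) = z.
Proof.
have [->|zN] := pselect (z = None); first by rewrite /stereo /= vec3E eqxx.
rewrite /stereo; case: eqP => [/stereo_inv2//|_].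
by case: z zN => [w|]// _; rewrite -affineE.
Qed.

(** This turns |xi|^2 / (1 + |z|^2) into |xi|^2 (1 - n_3) / 2, the form in which rho is compared
    with the null vectors. *)
Lemma one_plus_normc2 z : z <> None ->
  1 + normc (affine z) ^+ 2 = 2 / (1 - stereo_inv z 0 j2).
Proof.
move=> zN; rewrite affineE normc2E/=.
have := stereo_inv_unit z; rewrite dotE.
have := stereo_inv2_neq zN.
set x := _ 0 j0; set y := _ 0 j1; set t := _ 0 j2 => d0 n1.
have -> : 1 + ((x / (1 - t)) ^+ 2 + (y / (1 - t)) ^+ 2) =
   ((1 - t) ^+ 2 + (x * x + y * y)) / (1 - t) ^+ 2 by field.
rewrite (_ : x * x + y * y = 1 - t * t); last by lra.
by field.
Qed.

(* With zeta = n_0 + i n_1, this is zeta |-> a^2 zeta - b^2 zeta^* - 2ab n_2 and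
   n_2 |-> (|a|^2 - |b|^2) n_2 + 2 Re (a b^* zeta). *)
Definition rot a b n : 'rV[R]_3 :=
  let: a1 +i* a2 := a in let: b1 +i* b2 := b in
  let x := n 0 j0 in let y := n 0 j1 in let t := n 0 j2 in
  vec3
   ((a1 ^+ 2 - a2 ^+ 2) * x - 2 * a1 * a2 * y - (b1 ^+ 2 - b2 ^+ 2) * x
      - 2 * b1 * b2 * y - 2 * (a1 * b1 - a2 * b2) * t)
   ((a1 ^+ 2 - a2 ^+ 2) * y + 2 * a1 * a2 * x - 2 * b1 * b2 * x
      + (b1 ^+ 2 - b2 ^+ 2) * y - 2 * (a1 * b2 + a2 * b1) * t)
   ((a1 ^+ 2 + a2 ^+ 2 - b1 ^+ 2 - b2 ^+ 2) * t
      + 2 * ((a1 * b1 + a2 * b2) * x - (a2 * b1 - a1 * b2) * y)).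

Arguments rot : simpl never.

Lemma dot_rot a b u v : normc a ^+ 2 + normc b ^+ 2 = 1 ->
  dot (rot a b u) (rot a b v) = dot u v.
Proof.
rewrite !normc2E; case: a => a1 a2; case: b => b1 b2 /= ab1.
(* For arbitrary [a] and [b] the map [rot] is a similarity of ratio |a|^2 + |b|^2, which is a
   polynomial identity. *)
transitivity ((a1 ^+ 2 + a2 ^+ 2 + (b1 ^+ 2 + b2 ^+ 2)) ^+ 2 * dot u v).
  by rewrite !dotE /rot !vec3E; ring.
by rewrite ab1 expr1n mul1r.
Qed.

Lemma complex_divE (x y p q : R) : p ^+ 2 + q ^+ 2 != 0 ->
  (x +i* y) / (p +i* q) =
  ((x * p + y * q) / (p ^+ 2 + q ^+ 2)) +i* ((y * p - x * q) / (p ^+ 2 + q ^+ 2)).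
Proof.
move=> d0; have D0 : p +i* q != 0.
  by apply: contra d0; rewrite eq_complex/= => /andP[/eqP-> /eqP->];
    rewrite expr0n/= addr0.
apply: (mulIf D0); rewrite divfK//.
by apply/eqP; rewrite eq_complex/=; apply/andP; split; apply/eqP; field.
Qed.

(** For finite z write the image as num / den, with num = u + i v and den = p + i q. The matrix is
    unitary, so |num|^2 + |den|^2 = 1 + |z|^2 ([N1]), and the rotated vector is (2 num den^*,
    |num|^2 - |den|^2) / (1 + |z|^2) ([key]). These homogeneous coordinates remain valid when den =
    0. *)
Lemma stereo_inv_rotation a b z : normc a ^+ 2 + normc b ^+ 2 = 1 ->
  stereo_inv (rotation a b z) = rot a b (stereo_inv z).
Proof.
rewrite !normc2E; case: a => a1 a2; case: b => b1 b2 /= ab1.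
case: z => [[x y]|] /=.
  have -> : - (b1 +i* b2)^* * (x +i* y) + (a1 +i* a2)^* =
      (- (b1 * x + b2 * y) + a1) +i* (b2 * x - b1 * y - a2).
    by apply/eqP; rewrite eq_complex /=; apply/andP; split; apply/eqP; ring.
  have -> : (a1 +i* a2) * (x +i* y) + (b1 +i* b2) =
      (a1 * x - a2 * y + b1) +i* (a1 * y + a2 * x + b2).
    by apply/eqP; rewrite eq_complex /=; apply/andP; split; apply/eqP; ring.
  set p := _ + a1; set q := _ - a2; set u := _ + b1; set v := _ + b2.
  have d0 := den_neq0 x y.
  have N1 : u ^+ 2 + v ^+ 2 + (p ^+ 2 + q ^+ 2) = 1 + (x ^+ 2 + y ^+ 2).
    transitivity ((a1 ^+ 2 + a2 ^+ 2 + (b1 ^+ 2 + b2 ^+ 2)) * (1 + (x ^+ 2 + y ^+ 2))).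
      by rewrite /u /v /p /q; ring.
    by rewrite ab1 mul1r.
  have key : rot (a1 +i* a2) (b1 +i* b2) ((1 + (x ^+ 2 + y ^+ 2))^-1 *:
      vec3 (2 * x) (2 * y) (x ^+ 2 + y ^+ 2 - 1)) =
    (1 + (x ^+ 2 + y ^+ 2))^-1 *: vec3 (2 * (u * p + v * q))
      (2 * (v * p - u * q)) (u ^+ 2 + v ^+ 2 - (p ^+ 2 + q ^+ 2)).
    by apply: rV3P; rewrite /rot !mxE !inordK//= /u /v /p /q; field.
  rewrite sqrt_sumsqK key; case: eqP => [[p0 q0]|pq0].
    have := N1; rewrite p0 q0 !expr0n/= !addr0 => N2.
    by apply: rV3P; rewrite !mxE !inordK//= ?p0 ?q0 ?mulr0 ?addr0 ?subr0 ?mulr0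
      ?expr0n/= ?addr0 ?subr0 ?N2 ?mulVf.
  have pq : p ^+ 2 + q ^+ 2 != 0.
    apply/negP; rewrite paddr_eq0 ?sqr_ge0// !sqrf_eq0 => /andP[/eqP p0 /eqP q0].
    by apply: pq0; rewrite p0 q0.
  rewrite complex_divE// /= sqrt_sumsqK.
  have nn : ((u * p + v * q) / (p ^+ 2 + q ^+ 2)) ^+ 2 +
     ((v * p - u * q) / (p ^+ 2 + q ^+ 2)) ^+ 2 = (u ^+ 2 + v ^+ 2) / (p ^+ 2 + q ^+ 2).
    by field.
  rewrite nn -N1.
  have N0 : u ^+ 2 + v ^+ 2 + (p ^+ 2 + q ^+ 2) != 0 by rewrite N1.
  have N0' : p ^+ 2 + q ^+ 2 + (u ^+ 2 + v ^+ 2) != 0 by rewrite addrC.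
  by apply: rV3P; rewrite !mxE !inordK//=; field; rewrite ?pq ?N0 ?N0'.
case: eqP => [[b10 b20]|b0].
  move: ab1; rewrite b10 b20 !expr0n/= !addr0 => ab1.
  by apply: rV3P; rewrite /rot !mxE !inordK//=; lra.
have bb : b1 ^+ 2 + b2 ^+ 2 != 0.
  apply/negP; rewrite paddr_eq0 ?sqr_ge0// !sqrf_eq0 => /andP[/eqP p0 /eqP q0].
  by apply: b0; rewrite p0 q0.
have bb' : b1 ^+ 2 + (- b2) ^+ 2 != 0 by rewrite sqrrN.
rewrite complex_divE//= sqrt_sumsqK !sqrrN.
have -> : ((a1 * b1 + a2 * - b2) / (b1 ^+ 2 + b2 ^+ 2)) ^+ 2 +
   ((a2 * b1 - a1 * - b2) / (b1 ^+ 2 + b2 ^+ 2)) ^+ 2 =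
   (a1 ^+ 2 + a2 ^+ 2) / (b1 ^+ 2 + b2 ^+ 2) by field.
have -> : a1 ^+ 2 + a2 ^+ 2 = 1 - (b1 ^+ 2 + b2 ^+ 2) by rewrite -ab1; ring.
have -> : 1 + (1 - (b1 ^+ 2 + b2 ^+ 2)) / (b1 ^+ 2 + b2 ^+ 2) =
  (b1 ^+ 2 + b2 ^+ 2)^-1 by field.
have A : a1 ^+ 2 + a2 ^+ 2 = 1 - (b1 ^+ 2 + b2 ^+ 2) by rewrite -ab1; ring.
by apply: rV3P; rewrite /rot !mxE !inordK//= ?A; field.
Qed.

End SphereAlgebra.

(** * The logarithmic form dg / (g - h) in terms of unit vectors *)

Section ConformalIdentity.
Context {R : realType}.
Variables m0 m1 m2 dm0 dm1 dm2 l0 l1 l2 : R.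
Hypothesis mm : m0 * m0 + m1 * m1 + m2 * m2 = 1.
Hypothesis ll : l0 * l0 + l1 * l1 + l2 * l2 = 1.
Hypothesis mdm : m0 * dm0 + m1 * dm1 + m2 * dm2 = 0.
Hypothesis m2n : 1 - m2 != 0.
Hypothesis mln : 1 - (m0 * l0 + m1 * l1 + m2 * l2) != 0.

Let u := m0 / (1 - m2).
Let v := m1 / (1 - m2).
Let du := (dm0 * (1 - m2) + m0 * dm2) / (1 - m2) ^+ 2.
Let dv := (dm1 * (1 - m2) + m1 * dm2) / (1 - m2) ^+ 2.
Let p := l0 / (1 - l2).
Let q := l1 / (1 - l2).

(** The squared chord |m - l|^2 = 2 (1 - <m, l>) in stereographic coordinates. *)
Lemma stereo_dist : 1 - l2 != 0 -> (u - p) ^+ 2 + (v - q) ^+ 2 =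
  2 * (1 - (m0 * l0 + m1 * l1 + m2 * l2)) / ((1 - m2) * (1 - l2)).
Proof.
move=> l2n; have -> : (u - p) ^+ 2 + (v - q) ^+ 2 =
    (m0 * m0 + m1 * m1) / (1 - m2) ^+ 2 + (l0 * l0 + l1 * l1) / (1 - l2) ^+ 2
    - 2 * (m0 * l0 + m1 * l1) / ((1 - m2) * (1 - l2)).
  by rewrite /u /v /p /q; field; rewrite m2n l2n.
have -> : m0 * m0 + m1 * m1 = 1 - m2 * m2 by rewrite -mm; ring.
have -> : l0 * l0 + l1 * l1 = 1 - l2 * l2 by rewrite -ll; ring.
by field; rewrite m2n l2n.
Qed.

(* Re (dg / (g - h)) = (d m_2 / (1 - m_2) - <dm, l> / (1 - <m, l>)) / 2, where
   g and h are the stereographic images of m and l. *)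
Lemma conformal_identity : 1 - l2 != 0 ->
  (du * (u - p) + dv * (v - q)) / ((u - p) ^+ 2 + (v - q) ^+ 2) =
  (dm2 / (1 - m2) - (dm0 * l0 + dm1 * l1 + dm2 * l2) /
    (1 - (m0 * l0 + m1 * l1 + m2 * l2))) / 2.
Proof.
move=> l2n; rewrite stereo_dist//.
set ml := m0 * l0 + m1 * l1 + m2 * l2.
have mln' : 1 - ml != 0 := mln.
set dml := dm0 * l0 + dm1 * l1 + dm2 * l2.
have -> : du * (u - p) + dv * (v - q) =
    ((dm0 * m0 + dm1 * m1) * (1 - m2) + (m0 * m0 + m1 * m1) * dm2) / (1 - m2) ^+ 3
    - ((dm0 * l0 + dm1 * l1) * (1 - m2) + (m0 * l0 + m1 * l1) * dm2) /
      ((1 - m2) ^+ 2 * (1 - l2)).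
  by rewrite /du /dv /u /v /p /q; field; rewrite m2n l2n.
have -> : m0 * m0 + m1 * m1 = 1 - m2 * m2 by rewrite -mm; ring.
have -> : dm0 * m0 + dm1 * m1 = - (m2 * dm2).
  by rewrite -[LHS]subr0 -mdm; ring.
have -> : m0 * l0 + m1 * l1 = ml - m2 * l2 by rewrite /ml; ring.
have -> : dm0 * l0 + dm1 * l1 = dml - dm2 * l2 by rewrite /dml; ring.
by field; rewrite m2n l2n mln'.
Qed.

(** When l is the pole the two logarithmic terms cancel, in agreement with the value 0 given to the
    integrand where h is infinite. *)
Lemma conformal_identity_pole : 1 - l2 = 0 ->
  0 = (dm2 / (1 - m2) - (dm0 * l0 + dm1 * l1 + dm2 * l2) /
    (1 - (m0 * l0 + m1 * l1 + m2 * l2))) / 2.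
Proof.
move=> l2n; have l21 : l2 = 1 by lra.
have /eqP : l0 ^+ 2 + l1 ^+ 2 = 0 by move: ll; rewrite l21; lra.
rewrite paddr_eq0 ?sqr_ge0// !sqrf_eq0 => /andP[/eqP -> /eqP ->].
by rewrite l21 !mulr0 !add0r !mulr1 subrr mul0r.
Qed.

End ConformalIdentity.

Lemma cexpD {R : realType} (z w : R[i]) : cexp (z + w) = cexp z * cexp w.
Proof.
case: z => a b; case: w => c d; rewrite /cexp /= expRD cosD sinD.
by apply/eqP; rewrite eq_complex/=; apply/andP; split; apply/eqP; ring.
Qed.

Lemma cexp0 {R : realType} : cexp (0 : R[i]) = 1.
Proof. by rewrite /cexp /= expR0 cos0 sin0 mulr1 mulr0. Qed.

(** * Growth of 1 - n_3 along a path *)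

Section Transport.
Context {R : realType} {S : topologicalType} (M : oriented_surface R S).
Variables G H : S -> riemann_sphere R.

Local Notation x := (stereo_inv \o G).
Local Notation y := (stereo_inv \o H).

Hypothesis sx : forall k, smooth_map M (fun p => x p 0 k).
Hypothesis sy : forall k, smooth_map M (fun p => y p 0 k).
Hypothesis xy1 : forall p, dot (x p) (y p) != 1.

Definition integrand (a : R -> S) (t : R) : R[i] :=
  if H (a t) is Some w
  then cderive (affine \o G \o a) t / (affine (G (a t)) - w) else 0.

Section Arc.
Variable a : R -> S.
Hypothesis sa : smooth_arc M a.

Let u s := x (a s) 0 j0 / (1 - x (a s) 0 j2).
Let v s := x (a s) 0 j1 / (1 - x (a s) 0 j2).
Let p s := y (a s) 0 j0 / (1 - y (a s) 0 j2).
Let q s := y (a s) 0 j1 / (1 - y (a s) 0 j2).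
Let dx k t : R := derive1 (fun s => x (a s) 0 k) t.

Lemma cx k (t : R) : 0 <= t <= 1 -> C1at (fun s => x (a s) 0 k) t.
Proof. exact: smooth_arc_C1 sa (sx k). Qed.

Lemma cx2 (t : R) : 0 <= t <= 1 -> C1at (fun s => 1 - x (a s) 0 j2) t.
Proof. by move=> t01; apply: C1atD (C1at_cst _ _) (C1atN (cx _ t01)). Qed.

Lemma is_derive_stereo k (t : R) : 0 <= t <= 1 -> G (a t) <> None ->
  C1at (fun s => x (a s) 0 k / (1 - x (a s) 0 j2)) t /\
  derive1 (fun s => x (a s) 0 k / (1 - x (a s) 0 j2)) t =
  (dx k t * (1 - x (a t) 0 j2) + x (a t) 0 k * dx j2 t) /
    (1 - x (a t) 0 j2) ^+ 2.
Proof.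
move=> t01 /stereo_inv2_neq d0; split.
  by apply: C1atM; [exact: cx|apply: C1atV => //; exact: cx2].
have dk := C1at_is_derive (cx k t01); have d2 := C1at_is_derive (cx j2 t01).
rewrite derive1E; apply: derive_val.
derive_by ltac:(idtac).
by rewrite /dx; field.
Qed.

Lemma cderive_affine (t : R) : cderive (affine \o G \o a) t = derive1 u t +i* derive1 v t.
Proof.
rewrite /cderive; congr (derive1 _ t +i* derive1 _ t); apply/funext => s /=;
  by rewrite affineE.
Qed.

Lemma integrand_Re (t : R) : 0 <= t <= 1 -> G (a t) <> None ->
  complex.Re (integrand a t) =
  (dx j2 t / (1 - x (a t) 0 j2) - arc_form x y a t) / 2.
Proof.
move=> t01 Gt.
have := @conformal_identity _ (x (a t) 0 j0) (x (a t) 0 j1)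
  (x (a t) 0 j2) (dx j0 t) (dx j1 t) (dx j2 t)
  (y (a t) 0 j0) (y (a t) 0 j1) (y (a t) 0 j2).
have := @conformal_identity_pole _ (x (a t) 0 j0) (x (a t) 0 j1)
  (x (a t) 0 j2) (dx j0 t) (dx j1 t) (dx j2 t)
  (y (a t) 0 j0) (y (a t) 0 j1) (y (a t) 0 j2).
have xx s : dot (x (a s)) (x (a s)) = 1 := stereo_inv_unit _.
have yy : dot (y (a t)) (y (a t)) = 1 := stereo_inv_unit _.
have xdx : x (a t) 0 j0 * dx j0 t + x (a t) 0 j1 * dx j1 t + x (a t) 0 j2 * dx j2 t = 0.
  have d0 := C1at_is_derive (cx j0 t01).
  have d1 := C1at_is_derive (cx j1 t01).
  have d2 := C1at_is_derive (cx j2 t01).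
  have D1 : is_derive t (1 : R) (fun s => x (a s) 0 j0 * x (a s) 0 j0 +
      x (a s) 0 j1 * x (a s) 0 j1 + x (a s) 0 j2 * x (a s) 0 j2)
    (2 * (x (a t) 0 j0 * dx j0 t + x (a t) 0 j1 * dx j1 t + x (a t) 0 j2 * dx j2 t)).
    derive_by ltac:(idtac).
    by rewrite /dx; ring.
  have E1 : (fun s => x (a s) 0 j0 * x (a s) 0 j0 +
      x (a s) 0 j1 * x (a s) 0 j1 + x (a s) 0 j2 * x (a s) 0 j2) = (fun=> 1).
    by apply/funext => s; rewrite -[LHS]dotE xx.
  rewrite E1 in D1.
  have := is_derive_unique D1 (is_derive_cstf 1 t 1).
  by move=> /eqP; rewrite mulf_eq0 pnatr_eq0 => /eqP.
have d0 := stereo_inv2_neq Gt.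
have xy0 : 1 - dot (x (a t)) (y (a t)) != 0 := dot_neq1 xy1 _.
rewrite dotE in xy0; rewrite dotE in yy.
have xxt := xx t; rewrite dotE in xxt.
move=> /(_ yy) Hpole /(_ xxt yy xdx d0 xy0) Hreg.
rewrite /arc_form dotE sum3E -!/(dx _ _) /integrand.
case Ht : (H (a t)) => [w|]; last first.
  rewrite -Hpole//= Ht /= vec3E subrr//.
have y2 : 1 - y (a t) 0 j2 != 0 by apply: stereo_inv2_neq; rewrite Ht.
rewrite -(Hreg y2).
have wE : w = p t +i* q t by rewrite -[w]/(affine (Some w)) -Ht affineE.
rewrite cderive_affine affineE wE.
have [_ E0] := is_derive_stereo j0 t01 Gt.
have [_ E1] := is_derive_stereo j1 t01 Gt.
rewrite -[x (a t) 0 j0 / _]/(u t) -[x (a t) 0 j1 / _]/(v t).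
have -> : (u t +i* v t) - (p t +i* q t) = (u t - p t) +i* (v t - q t) by [].
rewrite complex_divE/=; last first.
  rewrite (stereo_dist xxt yy d0 y2) mulf_neq0 ?mulf_neq0//.
  by rewrite invr_eq0 mulf_neq0.
by rewrite [derive1 u t]E0 [derive1 v t]E1.
Qed.

(** By [integrand_Re], dlog (1 - n_3) = - 2 Re (dg / (g - h)) - w: a linear equation for 1 - n_3,
    solved by [linear_ode]. *)
Lemma transport_arc : (forall t : R, 0 <= t <= 1 -> G (a t) <> None) ->
  1 - x (a 1) 0 j2 = (1 - x (a 0) 0 j2) *
    expR (- 2 * complex.Re (cintegral01 (integrand a)) - arc_int x y a).
Proof.
move=> Gf; have [P [dP ->]] := arc_primitive sx sy xy1 sa.
(* The integrand is defined by cases on [H (a t)]. It agrees on [0, 1] with [f], whose continuity is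
   visible even where H is infinite. *)
pose f t : R := (dx j2 t / (1 - x (a t) 0 j2) - arc_form x y a t) / 2.
have cf (t : R) : 0 <= t <= 1 -> {for t, continuous f}.
  move=> t01; have d0 := stereo_inv2_neq (Gf t t01).
  have c1 := (cx j2 t01).2.
  have c2 : {for t, continuous (fun s => (1 - x (a s) 0 j2)^-1)}.
    by apply: (cvgV d0); exact: (C1at_cts (cx2 t01)).
  have c3 := arc_form_continuous sx sy xy1 sa t01.
  have c4 : {for t, continuous (fun s => dx j2 s / (1 - x (a s) 0 j2))} :=
    cvgM c1 c2.
  have c5 : {for t, continuous (fun s => dx j2 s / (1 - x (a s) 0 j2) -
    arc_form x y a s)} .
    by apply: (@cvgB _ R); [exact: c4|exact: c3].
  exact: (cvgM c5 (cvg_cst _)).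
have [Q [dQ QE]] := primitive_exists cf.
have -> : complex.Re (cintegral01 (integrand a)) = Q 1 - Q 0.
  rewrite -QE /=; apply: eq_Rintegral => t; rewrite inE/= in_itv/= => t01.
  by rewrite integrand_Re//; exact: Gf.
have -> : - 2 * (Q 1 - Q 0) - (P 1 - P 0) =
  (- 2 * Q 1 - P 1) - (- 2 * Q 0 - P 0) by ring.
apply: (@linear_ode _ (fun t => - 2 * Q t - P t)
  (fun t => - 2 * f t - arc_form x y a t) (fun t => 1 - x (a t) 0 j2)).
  move=> t t01; have hQ := dQ t t01; have hP := dP t t01.
  by derive_by ltac:(ring).
move=> t t01; have d0 := stereo_inv2_neq (Gf t t01).
have d2 := C1at_is_derive (cx j2 t01).
derive_by ltac:(idtac).
by rewrite /f /dx; field.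
Qed.

End Arc.

Lemma transport_path c r s : is_path M r c s ->
  along c (fun p => G p <> None) ->
  1 - x s 0 j2 = (1 - x r 0 j2) *
    expR (- 2 * complex.Re (path_integral G H c) - path_int x y c).
Proof.
elim: c r => [|a c IH] r /=.
  by move=> -> _; rewrite /path_integral /path_int !big_nil/= mulr0 subr0 expR0 mulr1.
move=> [sa a0 pc] [Ga Gc]; rewrite (IH _ pc Gc) (transport_arc sa Ga) a0.
rewrite -mulrA -expRD /path_integral /path_int !big_cons -!/(path_integral _ _ _).
congr (_ * expR _); rewrite [complex.Re (_ + _)]raddfD/=; ring.
Qed.

End Transport.

(** * The difference g - h along a path on which both are finite *)

Section FiniteIntegrand.
Context {R : realType} {S : topologicalType} (M : oriented_surface R S).

Definition re_affine (G : S -> riemann_sphere R) (a : R -> S) (s : R) : R :=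
  complex.Re (affine (G (a s))).

Definition im_affine (G : S -> riemann_sphere R) (a : R -> S) (s : R) : R :=
  complex.Im (affine (G (a s))).

Lemma affine_C1 (G : S -> riemann_sphere R) a (t : R) :
  (forall k, smooth_map M (fun p => stereo_inv (G p) 0 k)) ->
  smooth_arc M a -> 0 <= t <= 1 -> G (a t) <> None ->
  C1at (re_affine G a) t /\ C1at (im_affine G a) t.
Proof.
move=> sx sa t01 Gt.
have := is_derive_stereo sx sa j0 t01 Gt.
have := is_derive_stereo sx sa j1 t01 Gt.
have -> : re_affine G a = (fun s => (stereo_inv \o G) (a s) 0 j0 /
    (1 - (stereo_inv \o G) (a s) 0 j2)).
  by apply/funext => s; rewrite /re_affine affineE.
have -> : im_affine G a = (fun s => (stereo_inv \o G) (a s) 0 j1 /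
    (1 - (stereo_inv \o G) (a s) 0 j2)).
  by apply/funext => s; rewrite /im_affine affineE.
by move=> [c1 _] [c0 _].
Qed.

Definition dist2 (G H : S -> riemann_sphere R) (a : R -> S) (t : R) : R :=
  (re_affine G a t - re_affine H a t) ^+ 2 +
  (im_affine G a t - im_affine H a t) ^+ 2.

Lemma dist2_neq0 (G H : S -> riemann_sphere R) a t :
  G (a t) <> None -> H (a t) <> None -> G (a t) <> H (a t) ->
  dist2 G H a t != 0.
Proof.
rewrite /dist2 /re_affine /im_affine.
case: (G (a t)) => [[x y]|]// _; case: (H (a t)) => [[x' y']|]// _ /= GH.
apply/negP; rewrite paddr_eq0 ?sqr_ge0// !sqrf_eq0 !subr_eq0 => /andP[/eqP e /eqP e'].
by apply: GH; rewrite e e'.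
Qed.

Section Pair.
Variables G H : S -> riemann_sphere R.
Hypothesis sx : forall k, smooth_map M (fun p => stereo_inv (G p) 0 k).
Hypothesis sy : forall k, smooth_map M (fun p => stereo_inv (H p) 0 k).
Hypothesis GH : forall p, G p <> H p.
Variable a : R -> S.
Hypothesis sa : smooth_arc M a.
Hypothesis Gf : forall t : R, 0 <= t <= 1 -> G (a t) <> None.
Hypothesis Hf : forall t : R, 0 <= t <= 1 -> H (a t) <> None.

Let u := re_affine G a.
Let v := im_affine G a.
Let p := re_affine H a.
Let q := im_affine H a.

Definition integrand_re (t : R) : R :=
  (derive1 u t * (u t - p t) + derive1 v t * (v t - q t)) / dist2 G H a t.

Definition integrand_im (t : R) : R :=
  (derive1 v t * (u t - p t) - derive1 u t * (v t - q t)) / dist2 G H a t.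

Lemma integrand_finite (t : R) : 0 <= t <= 1 ->
  integrand G H a t = integrand_re t +i* integrand_im t.
Proof.
move=> t01; rewrite /integrand.
have n0 : dist2 G H a t != 0 by apply: dist2_neq0; [exact: Gf|exact: Hf|exact: GH].
have wE : affine (H (a t)) = p t +i* q t.
  by rewrite /p /q /re_affine /im_affine; case: (affine (H (a t))).
case Ht : (H (a t)) (Hf t01) => [w|]// _.
have {wE} -> : w = p t +i* q t by rewrite -wE Ht.
have -> : affine (G (a t)) = u t +i* v t.
  by rewrite /u /v /re_affine /im_affine; case: (affine (G (a t))).
have -> : (u t +i* v t) - (p t +i* q t) = (u t - p t) +i* (v t - q t) by [].
by rewrite complex_divE.
Qed.

Lemma integrand_primitive : exists P Q : R -> R,
  [/\ forall t : R, 0 <= t <= 1 -> is_derive t (1 : R) P (integrand_re t),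
      forall t : R, 0 <= t <= 1 -> is_derive t (1 : R) Q (integrand_im t)
    & cintegral01 (integrand G H a) = (P 1 - P 0) +i* (Q 1 - Q 0)].
Proof.
have cont (t : R) : 0 <= t <= 1 ->
    {for t, continuous integrand_re} /\ {for t, continuous integrand_im}.
  move=> t01; have n0 : dist2 G H a t != 0 by apply: dist2_neq0; [exact: Gf|exact: Hf|exact: GH].
  have [cu cv] := affine_C1 sx sa t01 (Gf t01).
  have [cp cq] := affine_C1 sy sa t01 (Hf t01).
  have cup : {for t, continuous (fun s => u s - p s)}.
    exact: (C1at_cts (C1atD cu (C1atN cp))).
  have cvq : {for t, continuous (fun s => v s - q s)}.
    exact: (C1at_cts (C1atD cv (C1atN cq))).
  have cn : {for t, continuous (fun s => (dist2 G H a s)^-1)}.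
    apply: (cvgV n0).
    by apply: (@cvgD _ R); rewrite !expr2; [exact: (cvgM cup cup)|exact: (cvgM cvq cvq)].
  split; (apply: cvgM; last exact: cn).
    by apply: (@cvgD _ R); apply: cvgM => //; [exact: cu.2|exact: cv.2].
  by apply: (@cvgB _ R); apply: cvgM => //; [exact: cv.2|exact: cu.2].
have [P [dP PE]] := primitive_exists (fun t t01 => (cont t t01).1).
have [Q [dQ QE]] := primitive_exists (fun t t01 => (cont t t01).2).
exists P, Q; split=> //; rewrite /cintegral01 -PE -QE.
congr (_ +i* _); apply: eq_Rintegral => t; rewrite inE/= in_itv/= => t01;
  by rewrite integrand_finite.
Qed.

End Pair.

Section Difference.
Variables G H : S -> riemann_sphere R.
Hypothesis sx : forall k, smooth_map M (fun p => stereo_inv (G p) 0 k).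
Hypothesis sy : forall k, smooth_map M (fun p => stereo_inv (H p) 0 k).
Hypothesis GH : forall p, G p <> H p.

(** Here the imaginary parts of the integrals count too, so the linear equation for g - h is solved
    over the complex numbers. *)
Lemma difference_arc a : smooth_arc M a ->
  (forall t : R, 0 <= t <= 1 -> G (a t) <> None /\ H (a t) <> None) ->
  affine (G (a 1)) - affine (H (a 1)) = (affine (G (a 0)) - affine (H (a 0))) *
    cexp (cintegral01 (integrand G H a) + cintegral01 (integrand H G a)).
Proof.
move=> sa fin.
have Gf (t : R) : 0 <= t <= 1 -> G (a t) <> None by move=> /fin[].
have Hf (t : R) : 0 <= t <= 1 -> H (a t) <> None by move=> /fin[].
have HG p : H p <> G p by move=> /esym; exact: GH.
have [P [Q [dP dQ ->]]] := integrand_primitive sx sy GH sa Gf Hf.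
have [P' [Q' [dP' dQ' ->]]] := integrand_primitive sy sx HG sa Hf Gf.
have -> : ((P 1 - P 0) +i* (Q 1 - Q 0)) + ((P' 1 - P' 0) +i* (Q' 1 - Q' 0)) =
    ((P 1 + P' 1) - (P 0 + P' 0)) +i* ((Q 1 + Q' 1) - (Q 0 + Q' 0)).
  by apply/eqP; rewrite eq_complex/=; apply/andP; split; apply/eqP; ring.
have dE s : affine (G (a s)) - affine (H (a s)) =
   (re_affine G a s - re_affine H a s) +i* (im_affine G a s - im_affine H a s).
  by rewrite /re_affine /im_affine; case: (affine (G _)) => ? ?; case: (affine (H _)).
rewrite !dE.
have dU (t : R) : 0 <= t <= 1 -> [/\ is_derive t (1 : R) (re_affine G a) (derive1 (re_affine G a) t),
   is_derive t (1 : R) (im_affine G a) (derive1 (im_affine G a) t),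
   is_derive t (1 : R) (re_affine H a) (derive1 (re_affine H a) t),
   is_derive t (1 : R) (im_affine H a) (derive1 (im_affine H a) t) &
   dist2 G H a t != 0].
  move=> t01; have [cu cv] := affine_C1 sx sa t01 (Gf t t01).
  have [cp cq] := affine_C1 sy sa t01 (Hf t t01).
  split; try exact: C1at_is_derive.
  by apply: dist2_neq0; [exact: Gf|exact: Hf|exact: GH].
have dHG t : dist2 H G a t = dist2 G H a t by rewrite /dist2; ring.
apply: (@complex_linear_ode _ (fun t => P t + P' t) (fun t => Q t + Q' t)
  (fun t => integrand_re G H a t + integrand_re H G a t)
  (fun t => integrand_im G H a t + integrand_im H G a t)
  (fun t => re_affine G a t - re_affine H a t)
  (fun t => im_affine G a t - im_affine H a t)) => t t01.
- have h1 := dP t t01; have h2 := dP' t t01; by derive_by ltac:(by []).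
- have h1 := dQ t t01; have h2 := dQ' t t01; by derive_by ltac:(by []).
- have [h1 h2 h3 h4 n0] := dU t t01; derive_by ltac:(idtac).
  rewrite /integrand_re /integrand_im dHG; move: n0; rewrite /dist2 => n0.
  by field.
- have [h1 h2 h3 h4 n0] := dU t t01; derive_by ltac:(idtac).
  rewrite /integrand_re /integrand_im dHG; move: n0; rewrite /dist2 => n0.
  by field.
Qed.

Lemma difference_path c r s : is_path M r c s ->
  along c (fun p => G p <> None /\ H p <> None) ->
  affine (G s) - affine (H s) = (affine (G r) - affine (H r)) *
    (cexp (path_integral G H c) * cexp (path_integral H G c)).
Proof.
rewrite -cexpD; elim: c r => [|a c IH] r /=.
  by move=> -> _; rewrite /path_integral !big_nil addr0 cexp0 mulr1.
move=> [sa a0 pc] [fa fc]; rewrite (IH _ pc fc) (difference_arc sa fa) a0.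
rewrite -mulrA -cexpD /path_integral !big_cons -!/(path_integral _ _ _).
congr (_ * cexp _); rewrite addrACA; congr (_ + _).
Qed.

End Difference.

End FiniteIntegrand.

(** * Rotations and curves that are not onto the sphere *)

Section Rotation.
Context {R : realType} {S : topologicalType} (M : oriented_surface R S).

Lemma rot_linear (a b : R[i]) (n : 'rV[R]_3) k :
  rot a b n 0 k = \sum_(j < 3) rot a b (delta_mx 0 j) 0 k * n 0 j.
Proof.
have E (i j : nat) : (i < 3)%N -> (j < 3)%N -> (inord i == inord j :> 'I_3) = (i == j).
  by move=> i3 j3; rewrite -val_eqE /= !inordK.
rewrite sum3E; case: a => a1 a2; case: b => b1 b2.
by elim/ord3P: k; rewrite /rot !vec3E !mxE !E//=; ring.
Qed.

Lemma rot_smooth (a b : R[i]) (x : S -> 'rV[R]_3) :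
  (forall k, smooth_map M (fun p => x p 0 k)) ->
  forall k, smooth_map M (fun p => rot a b (x p) 0 k).
Proof.
move=> sx k i n; have oU : open (chart M i @` dom M i) := @chart_open R S M i.
rewrite (_ : _ \o _ = (fun z =>
  \sum_(j < 3) rot a b (delta_mx 0 j) 0 k * x (param M i z) 0 j)); last first.
  by apply/funext => z /=; exact: rot_linear.
apply: Ck_on_sum => // j; apply: Ck_onM oU (Ck_on_cst _ _ oU) _.
exact: sx.
Qed.

Lemma rot_derive1 (a b : R[i]) (x : R -> 'rV[R]_3) (t : R) k :
  (forall j, derivable (fun s => x s 0 j) t 1) ->
  derive1 (fun s => rot a b (x s) 0 k) t =
  rot a b (\row_j derive1 (fun s => x s 0 j) t) 0 k.
Proof.
move=> dx; rewrite derive1E; apply: derive_val.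
rewrite (_ : (fun s => _) = (fun s => rot a b (delta_mx 0 j0) 0 k * x s 0 j0 +
  rot a b (delta_mx 0 j1) 0 k * x s 0 j1 + rot a b (delta_mx 0 j2) 0 k * x s 0 j2)).
  have d0 := derivableP (dx j0); have d1 := derivableP (dx j1).
  have d2 := derivableP (dx j2).
  rewrite [X in is_derive _ _ _ X]rot_linear sum3E 3![in X in is_derive _ _ _ X]mxE.
  rewrite !derive1E.
  by derive_by ltac:(ring).
by apply/funext => s; rewrite rot_linear sum3E.
Qed.

Section Invariance.
Variables (x y : S -> 'rV[R]_3) (a b : R[i]).
Hypothesis sx : forall k, smooth_map M (fun p => x p 0 k).
Hypothesis ab : normc a ^+ 2 + normc b ^+ 2 = 1.

Lemma arc_int_rot c : smooth_arc M c ->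
  arc_int (rot a b \o x) (rot a b \o y) c = arc_int x y c.
Proof.
move=> sc; apply: eq_Rintegral => t; rewrite inE/= in_itv/= => t01.
rewrite /arc_form /= dot_rot//; congr (_ / _).
have dx j : derivable (fun s => x (c s) 0 j) t 1.
  by have [] := C1at_is_derive (smooth_arc_C1 sc (sx j) t01).
under eq_bigr do rewrite (rot_derive1 _ _ _ dx).
rewrite -[LHS]/(dot _ _) dot_rot//.
by apply: eq_bigr => k _; rewrite mxE.
Qed.

Lemma path_int_rot p c q : is_path M p c q ->
  path_int (rot a b \o x) (rot a b \o y) c = path_int x y c.
Proof.
elim: c p => [|c cs IH] p /=; first by rewrite /path_int !big_nil.
move=> [sc _ /IH]; rewrite /path_int !big_cons => ->.
by rewrite arc_int_rot.
Qed.

End Invariance.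

End Rotation.

Section Packing.
Context {R : realType}.

(** The constant is the maximum of |u'| on the compact interval. *)
Lemma C1_lipschitz (u : R -> R) : (forall t : R, 0 <= t <= 1 -> C1at u t) ->
  exists K : R, 0 <= K /\ forall s t : R, 0 <= s <= 1 -> 0 <= t <= 1 ->
    `|u s - u t| <= K * `|s - t|.
Proof.
move=> cu.
have cd : {within `[0, 1 : R], continuous (fun t => `|derive1 u t|)}.
  apply: continuous_in_subspaceT => t; rewrite inE/= in_itv/= => t01.
  by apply: cvg_norm; exact: (cu t t01).2.
have [c c01 cP] := EVT_max ler01 cd.
exists `|derive1 u c|; split=> // s t.
wlog st : s t / s <= t.
  move=> H s01 t01; case/orP: (le_total s t) => h; first exact: H.
  by rewrite distrC (distrC s); exact: H.
move=> /andP[s0 s1] /andP[t0 t1].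
have I01 r : r \in `[s, t] -> 0 <= r <= 1.
  by rewrite in_itv/= => /andP[sr rt]; rewrite (le_trans s0 sr) (le_trans rt t1).
have dr r : r \in `]s, t[ -> is_derive r (1 : R) u (derive1 u r).
  by move=> /subset_itv_oo_cc/I01/cu/C1at_is_derive.
have [|r rst E] := MVT_segment st dr.
  by apply: derivable_within_continuous => r /I01/cu/C1at_is_derive[].
rewrite distrC E normrM (distrC s) ler_wpM2r//.
by apply: cP; rewrite in_itv/=; exact: I01.
Qed.

(* n curves of Lipschitz constant K are covered by O(n K m) sets of diameter less
   than 1/(2m), each of which contains at most one of m^2 grid points. *)
Lemma lipschitz_curves_miss n (X Y : 'I_n -> R -> R) (K : R) :
  (forall i (s t : R), 0 <= s <= 1 -> 0 <= t <= 1 ->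
     `|X i s - X i t| <= K * `|s - t| /\ `|Y i s - Y i t| <= K * `|s - t|) ->
  exists z w : R, [/\ 0 <= z <= 2^-1, 0 <= w <= 2^-1 &
    forall i (t : R), 0 <= t <= 1 -> ~ (X i t = z /\ Y i t = w)].
Proof.
move=> lip; apply: contrapT => nE.
have hit (z w : R) : 0 <= z <= 2^-1 -> 0 <= w <= 2^-1 ->
    exists it : 'I_n * R, 0 <= it.2 <= 1 /\ X it.1 it.2 = z /\ Y it.1 it.2 = w.
  move=> z01 w01; apply: contrapT => nE'; apply: nE; exists z, w; split=> // i t t01 E.
  by apply: nE'; exists (i, t).
have [k kK] : exists k : nat, K <= k%:R.
  exists (Num.truncn `|K|).+1.
  by rewrite (le_trans (ler_norm _))// ltW// truncnS_gt.
(* The grid has step 1/(2m). With N = 2mk + 1, a parameter interval of length 1/N moves a curve by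
   at most k/N < 1/(2m), so each pair (curve, interval) meets at most one grid point. The number of
   pairs, n (N + 1) = 2nkm + 2n, is below m^2 by the choice of m. *)
have [m mE] : exists m, m = (2 * n * k + 2 * n).+1 by eexists.
have [N NE] : exists N, N = (2 * m * k).+1 by eexists.
pose pt (j : 'I_m) : R := j%:R / (2 * m)%:R.
have m0 : 0 < (2 * m)%:R :> R by rewrite ltr0n mE.
have pt01 j : 0 <= pt j <= 2^-1.
  rewrite /pt divr_ge0//= ler_pdivrMr// natrM mulKf ?pnatr_eq0// ler_nat.
  exact: ltnW.
have /choice[f fP] : forall jk : 'I_m * 'I_m, exists it : 'I_n * R,
    0 <= it.2 <= 1 /\ X it.1 it.2 = pt jk.1 /\ Y it.1 it.2 = pt jk.2.
  by move=> jk; exact: hit.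
have N0 : 0 < N%:R :> R by rewrite ltr0n NE.
(* The parameter [t = 1] has index N, hence N + 1 cells. *)
pose cell (t : R) : 'I_N.+1 := inord (Num.truncn (t * N%:R)).
have cellP (s t : R) : 0 <= s <= 1 -> 0 <= t <= 1 -> cell s = cell t ->
    `|s - t| * N%:R <= 1.
  move=> s01 t01; have bd (r : R) : 0 <= r <= 1 ->
      (Num.truncn (r * N%:R) < N.+1)%N /\ (cell r)%:R <= r * N%:R < (cell r).+1%:R.
    move=> /andP[r0 r1]; have rN : 0 <= r * N%:R by rewrite mulr_ge0// ltW.
    have /andP[l h] := truncn_itv rN.
    have lN : (Num.truncn (r * N%:R) < N.+1)%N.
      rewrite ltnS -(ler_nat R) (le_trans l)// ler_piMl// ltW//.
    by rewrite /cell inordK// l h.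
  move=> st; have [_ /andP[sl sh]] := bd s s01; have [_ /andP[tl th]] := bd t t01.
  rewrite -st in tl th; rewrite -(gtr0_norm N0) -normrM mulrBl ler_norml.
  by move: sh th; rewrite -natr1; lra.
pose F (jk : 'I_m * 'I_m) : 'I_n * 'I_N.+1 := ((f jk).1, cell (f jk).2).
(* Distinct indices differ by at least 1, whereas |j - j'| <= 2mk |s - t| = (N - 1) |s - t| < 1. *)
have close (Z : 'I_n -> R -> R) i (s t : R) (j j' : 'I_m) :
    `|Z i s - Z i t| <= K * `|s - t| -> `|s - t| * N%:R <= 1 ->
    Z i s = pt j -> Z i t = pt j' -> j = j'.
  move=> ZK stN Zs Zt; apply/val_inj/eqP; rewrite -(eqr_nat R) -subr_eq0.
  apply: contraT => jj'.
  have one : 1 <= `|(val j)%:R - (val j')%:R : R|.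
    rewrite -[(val j)%:R]/((Posz j)%:~R) -[(val j')%:R]/((Posz j')%:~R) -intrB.
    rewrite -intr_norm -[1]/(1%:~R) ler_int.
    by rewrite -gtz0_ge1 normr_gt0 -(intr_eq0 R) intrB.
  have : `|(val j)%:R - (val j')%:R : R| <= K * `|s - t| * (2 * m)%:R.
    rewrite -ler_pdivrMr//; apply: le_trans ZK; rewrite Zs Zt /pt -mulrBl.
    by rewrite normrM [`|_^-1|]gtr0_norm// invr_gt0.
  have st0 : 0 <= `|s - t| by [].
  have : K * `|s - t| * (2 * m)%:R <= k%:R * `|s - t| * (2 * m)%:R.
    by rewrite !ler_wpM2r// ltW.
  have : k%:R * `|s - t| * (2 * m)%:R = `|s - t| * (N%:R - 1).
    by rewrite NE -natr1 addrK [in RHS]natrM; ring.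
  have [->|st1] := eqVneq `|s - t| 0; first by lra.
  have : 0 < `|s - t| by rewrite lt_def st1.
  by lra.
have injF : injective F.
  move=> [j l] [j' l'] [fi fc].
  have [t01 [Xj Yl]] := fP (j, l); have [t01' [Xj' Yl']] := fP (j', l').
  rewrite -fi in Xj' Yl'.
  have stN := cellP _ _ t01 t01' fc.
  have [lX lY] := lip (f (j, l)).1 _ _ t01 t01'.
  have /= -> := close X _ _ _ _ _ lX stN Xj Xj'.
by have /= -> := close Y _ _ _ _ _ lY stN Yl Yl'.
have := leq_card F injF; rewrite !card_prod !card_ord.
apply/negP; rewrite -ltnNge.
have -> : (n * N.+1 = m * (2 * n * k) + 2 * n)%N.
  rewrite NE !mulnS addnA addnn -mul2n addnC; congr (_ + _)%N.
  rewrite -!mulnA [LHS]mulnCA [RHS]mulnCA; congr (_ * _)%N; exact: mulnCA.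
have -> : (m * m = m * (2 * n * k) + (m * (2 * n) + m))%N.
  by rewrite {2}mE mulnS mulnDr addnC -addnA.
have m1 : (0 < m)%N by rewrite mE.
rewrite ltn_add2l (@leq_ltn_trans (m * (2 * n)))//; first exact: leq_pmull.
by rewrite -[ltnLHS]addn0 ltn_add2l.
Qed.

End Packing.

(** * Frontals *)

Section SmoothMaps.
Context {R : realType} {S : topologicalType} (M : oriented_surface R S).

Lemma Ck_on_lin {V W W' : normedModType R} (l : W -> W') k (U : set V) (f : V -> W) :
  linear l -> continuous l -> open U -> Ck_on k U f -> Ck_on k U (l \o f).
Proof.
move=> lin_l cl oU kf.
pose lM := GRing.isLinear.Build _ _ _ _ _ lin_l.
pose L : {linear W -> W'} := HB.pack l lM.
exact: (@Ck_on_linear _ _ _ _ L).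
Qed.

Lemma is_derive_lin {V W W' : normedModType R} (l : W -> W') (f : V -> W) z v df :
  linear l -> continuous l -> is_derive z v f df -> is_derive z v (l \o f) (l df).
Proof.
move=> lin_l cl fd.
pose lM := GRing.isLinear.Build _ _ _ _ _ lin_l.
pose L : {linear W -> W'} := HB.pack l lM.
exact: (@is_derive_linear _ _ _ _ L).
Qed.

Lemma chart_image_open i : open (chart M i @` dom M i).
Proof. exact: chart_open. Qed.

Lemma smooth_lin {W W' : normedModType R} (l : W -> W') (f : S -> W) :
  linear l -> continuous l -> smooth_map M f -> smooth_map M (fun p => l (f p)).
Proof. by move=> ll cl sf i k; exact: (Ck_on_lin ll cl (@chart_image_open i) (sf i k)). Qed.

Lemma linear_rV_coord k : linear (fun u : 'rV[R]_3 => u 0 k).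
Proof. by move=> a u v; rewrite !mxE. Qed.

Lemma smooth_coord (f : S -> 'rV[R]_3) k :
  smooth_map M f -> smooth_map M (fun p => f p 0 k).
Proof.
apply: (smooth_lin (@linear_rV_coord k)); exact: coord_continuous.
Qed.

Lemma linear_fst : linear (fun u : R * 'rV[R]_3 => u.1). Proof. by []. Qed.

Lemma continuous_fst : continuous (fun u : R * 'rV[R]_3 => u.1).
Proof. by move=> u; exact: cvg_fst. Qed.

Lemma continuous_snd : continuous (fun u : R * 'rV[R]_3 => u.2).
Proof. by move=> u; exact: cvg_snd. Qed.

Lemma linear_snd_coord k : linear (fun u : R * 'rV[R]_3 => u.2 0 k).
Proof. by move=> a u v; rewrite /= !mxE. Qed.

Lemma continuous_snd_coord k : continuous (fun u : R * 'rV[R]_3 => u.2 0 k).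
Proof.
move=> u; apply: (@continuous_comp _ _ _ (fun u : R * 'rV[R]_3 => u.2)
  (fun u : 'rV[R]_3 => u 0 k)); first exact: continuous_snd.
exact: coord_continuous.
Qed.

Lemma smoothD {W : normedModType R} (f g : S -> W) :
  smooth_map M f -> smooth_map M g -> smooth_map M (fun p => f p + g p).
Proof.
by move=> sf sg i k; apply: Ck_onD (@chart_image_open i) (sf i k) (sg i k).
Qed.

Lemma smoothM (f g : S -> R) :
  smooth_map M f -> smooth_map M g -> smooth_map M (fun p => f p * g p).
Proof.
by move=> sf sg i k; apply: Ck_onM (@chart_image_open i) (sf i k) (sg i k).
Qed.

Lemma smooth_cst {W : normedModType R} (c : W) : smooth_map M (fun=> c).
Proof. by move=> i k; exact: Ck_on_cst _ _ (@chart_image_open i). Qed.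

Lemma smoothN (f : S -> R) : smooth_map M f -> smooth_map M (fun p => - f p).
Proof. by move=> sf i k; apply: Ck_onN (@chart_image_open i) (sf i k). Qed.

Lemma smoothV (f : S -> R) : (forall p, f p != 0) ->
  smooth_map M f -> smooth_map M (fun p => (f p)^-1).
Proof.
by move=> f0 sf i k; apply: Ck_onV (@chart_image_open i) _ (sf i k) => z _ /=.
Qed.

Lemma smooth_expR (f : S -> R) : smooth_map M f -> smooth_map M (fun p => expR (f p)).
Proof. by move=> sf i k; apply: Ck_on_expR (@chart_image_open i) (sf i k). Qed.

Lemma smooth_scale {W : normedModType R} (f : S -> R) (w : W) :
  smooth_map M f -> smooth_map M (fun p => f p *: w).
Proof.
apply: (@smooth_lin _ _ (fun r : R => r *: w)).
  by move=> a r s; rewrite scalerDl scalerA.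
by move=> r; apply: cvgZr_tmp; exact: cvg_id.
Qed.

Lemma smooth_pair (f : S -> R) (g : S -> 'rV[R]_3) : smooth_map M f ->
  (forall k, smooth_map M (fun p => g p 0 k)) -> smooth_map M (fun p => (f p, g p)).
Proof.
move=> sf sg; rewrite (_ : (fun p => (f p, g p)) = fun p =>
    f p *: (1, 0) + \sum_(k < 3) g p 0 k *: (0, delta_mx 0 k)).
  apply: smoothD; first exact: smooth_scale.
  move=> i n; apply: Ck_on_sum => [|k]; first exact: chart_image_open.
  exact: (@smooth_scale _ (fun p => g p 0 k) _ (sg k) i n).
apply/funext => p; rewrite {1}[g p]row_sum_delta.
rewrite [RHS]surjective_pairing; congr (_, _) => /=.
  by rewrite raddf_sum/= big1 ?addr0 ?[_ *: _]mulr1// => k _; exact: mulr0.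
by rewrite raddf_sum/= scaler0 add0r.
Qed.

Lemma smooth_derive (f : S -> R) i z v : smooth_map M f ->
  (chart M i @` dom M i) z ->
  is_derive z v (f \o param M i) ('D_v (f \o param M i) z).
Proof. by move=> sf Uz; exact: Ck_on_is_derive (sf i 1%N) Uz. Qed.

End SmoothMaps.

Section FrontalAlgebra.
Context {R : realType}.

Lemma null_direction (t : R) (w : 'rV[R]_3) z : t != 0 -> dot w w = t ^+ 2 ->
  stereo (t^-1 *: w) = z -> w = t *: stereo_inv z.
Proof.
move=> t0 ww <-; rewrite stereoK; first by rewrite scalerA mulfV// scale1r.
transitivity (t^-1 ^+ 2 * dot w w); first by rewrite !dotE !mxE; ring.
by rewrite ww; field.
Qed.

Variables (al be dal dbe : R) (x y dx dy : 'I_3 -> R).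
Let dt (u v : 'I_3 -> R) := \sum_k u k * v k.

(** The last hypothesis is the derivative of the constant al be (1 - <x, y>). It eliminates [dbe]
    and [dy], leaving a condition on [dal] alone. *)
Lemma frontal_contact :
  dt x x = 1 -> dt y y = 1 -> dt x dx = 0 -> dt y dy = 0 ->
  (dal * be + al * dbe) * (1 - dt x y) = al * be * (dt dx y + dt x dy) ->
  - ((dal + dbe) * (al - be)) +
    \sum_k (dal * x k + al * dx k + (dbe * y k + be * dy k)) * (al * x k - be * y k) =
  2 * be * (dal * (1 - dt x y) - al * dt dx y).
Proof.
rewrite /dt !sum3E => xx yy xdx ydy E.
set lhs := (LHS); have -> : lhs =
   - ((dal + dbe) * (al - be)) + al * dal * (x j0 * x j0 + x j1 * x j1 + x j2 * x j2)
   - be * dbe * (y j0 * y j0 + y j1 * y j1 + y j2 * y j2)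
   + al * al * (x j0 * dx j0 + x j1 * dx j1 + x j2 * dx j2)
   - be * be * (y j0 * dy j0 + y j1 * dy j1 + y j2 * dy j2)
   + (dbe * al - dal * be) * (x j0 * y j0 + x j1 * y j1 + x j2 * y j2)
   + (al * be * (dx j0 * y j0 + dx j1 * y j1 + dx j2 * y j2 +
      (x j0 * dy j0 + x j1 * dy j1 + x j2 * dy j2)))
   - 2 * al * be * (dx j0 * y j0 + dx j1 * y j1 + dx j2 * y j2).
  by rewrite /lhs; ring.
by rewrite -E xx yy xdx ydy; ring.
Qed.

End FrontalAlgebra.

Section Frontal.
Context {R : realType} {S : topologicalType} (M : oriented_surface R S).
Variables Gp Gm : S -> riemann_sphere R.
Local Notation x := (stereo_inv \o Gp).
Local Notation y := (stereo_inv \o Gm).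
Hypothesis sx : forall k, smooth_map M (fun p => x p 0 k).
Hypothesis sy : forall k, smooth_map M (fun p => y p 0 k).
Hypothesis xy1 : forall p, dot (x p) (y p) != 1.

(* X + N and X - N are the null vectors 2 al (1, x) and 2 be (1, y). *)
Record null_frame (X N : S -> R * 'rV[R]_3) (al be : S -> R) : Prop := NullFrame {
  frame_al : smooth_map M al;
  frame_be : smooth_map M be;
  frame_prod : forall p, al p * be p * (1 - dot (x p) (y p)) = 2^-1;
  frame_X : forall p, X p = (al p + be p, al p *: x p + be p *: y p);
  frame_N : forall p, N p = (al p - be p, al p *: x p - be p *: y p) }.

Lemma frame_neq0 X N al be p : null_frame X N al be -> al p != 0 /\ be p != 0.
Proof.
move=> /frame_prod/(_ p) E.
have : al p * be p * (1 - dot (x p) (y p)) != 0 by rewrite E invr_eq0 pnatr_eq0.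
by rewrite !mulf_eq0 !negb_or => /andP[/andP[]].
Qed.

Lemma frame_smooth X N al be : null_frame X N al be ->
  smooth_map M X /\ smooth_map M N.
Proof.
move=> [sal sbe _ XE NE].
have -> : X = fun p => (al p + be p, al p *: x p + be p *: y p) by apply/funext.
have -> : N = fun p => (al p - be p, al p *: x p - be p *: y p) by apply/funext.
split; apply: smooth_pair.
- exact: smoothD.
- move=> k; rewrite (_ : (fun p => _) = fun p => al p * x p 0 k + be p * y p 0 k).
    by apply: smoothD; apply: smoothM.
  by apply/funext => p; rewrite !mxE.
- by apply: smoothD => //; exact: smoothN.
- move=> k; rewrite (_ : (fun p => _) = fun p => al p * x p 0 k + - (be p * y p 0 k)).
    by apply: smoothD; [exact: smoothM|apply: smoothN; exact: smoothM].
  by apply/funext => p; rewrite !mxE.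
Qed.

Lemma frame_lorentz X N al be p : null_frame X N al be ->
  [/\ lorentz (X p) (X p) = -1, lorentz (N p) (N p) = 1 & lorentz (N p) (X p) = 0].
Proof.
move=> [_ _ prod XE NE]; have := prod p.
have := stereo_inv_unit (Gp p); have := stereo_inv_unit (Gm p).
rewrite XE NE /lorentz !dotE !mxE /=.
set x0 := stereo_inv (Gp p) 0 j0; set x1 := stereo_inv (Gp p) 0 j1.
set x2 := stereo_inv (Gp p) 0 j2; set y0 := stereo_inv (Gm p) 0 j0.
set y1 := stereo_inv (Gm p) 0 j1; set y2 := stereo_inv (Gm p) 0 j2.
set A := al p; set B := be p => yy xx E.
split.
- transitivity (A * A * (x0 * x0 + x1 * x1 + x2 * x2 - 1) +
    B * B * (y0 * y0 + y1 * y1 + y2 * y2 - 1) -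
    2 * (A * B * (1 - (x0 * y0 + x1 * y1 + x2 * y2)))); first by ring.
  by rewrite xx yy E; field.
- transitivity (A * A * (x0 * x0 + x1 * x1 + x2 * x2 - 1) +
    B * B * (y0 * y0 + y1 * y1 + y2 * y2 - 1) +
    2 * (A * B * (1 - (x0 * y0 + x1 * y1 + x2 * y2)))); first by ring.
  by rewrite xx yy E; field.
- transitivity (A * A * (x0 * x0 + x1 * x1 + x2 * x2 - 1) -
    B * B * (y0 * y0 + y1 * y1 + y2 * y2 - 1)); first by ring.
  by rewrite xx yy; ring.
Qed.

Lemma frame_gauss X N al be : null_frame X N al be -> gauss_maps_are X N Gp Gm.
Proof.
move=> F; have [_ _ _ XE NE] := F; split=> p; have [a0 b0] := frame_neq0 p F.
  rewrite /gauss_plus XE NE /=.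
  have -> : al p + be p + (al p - be p) = 2 * al p by ring.
  have -> : al p *: stereo_inv (Gp p) + be p *: stereo_inv (Gm p) +
      (al p *: stereo_inv (Gp p) - be p *: stereo_inv (Gm p)) =
      (2 * al p) *: stereo_inv (Gp p).
    by apply/rowP => k; rewrite !mxE; ring.
  by rewrite scalerA mulVf ?scale1r ?stereo_invK// mulf_neq0// pnatr_eq0.
rewrite /gauss_minus XE NE /=.
have -> : al p + be p - (al p - be p) = 2 * be p by ring.
have -> : al p *: stereo_inv (Gp p) + be p *: stereo_inv (Gm p) -
    (al p *: stereo_inv (Gp p) - be p *: stereo_inv (Gm p)) =
    (2 * be p) *: stereo_inv (Gm p).
  by apply/rowP => k; rewrite !mxE; ring.
by rewrite scalerA mulVf ?scale1r ?stereo_invK// mulf_neq0// pnatr_eq0.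
Qed.

Lemma unit_derive (G : S -> riemann_sphere R) i z v :
  (forall k, smooth_map M (fun p => stereo_inv (G p) 0 k)) ->
  (chart M i @` dom M i) z ->
  \sum_(k < 3) stereo_inv (G (param M i z)) 0 k *
    'D_v (fun w => stereo_inv (G (param M i w)) 0 k) z = 0.
Proof.
move=> sG Uz.
have d0 := smooth_derive v (sG j0) Uz; have d1 := smooth_derive v (sG j1) Uz.
have d2 := smooth_derive v (sG j2) Uz.
rewrite /comp in d0 d1 d2.
pose n w := stereo_inv (G (param M i w)).
have D1 : is_derive z v (fun w => n w 0 j0 * n w 0 j0 + n w 0 j1 * n w 0 j1 +
    n w 0 j2 * n w 0 j2)
  (2 * (\sum_(k < 3) n z 0 k * 'D_v (fun w => n w 0 k) z)).
  by rewrite sum3E; derive_by ltac:(ring).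
have E1 : (fun w => n w 0 j0 * n w 0 j0 + n w 0 j1 * n w 0 j1 +
    n w 0 j2 * n w 0 j2) = (fun=> 1).
  by apply/funext => w; rewrite -[LHS]dotE stereo_inv_unit.
rewrite E1 in D1.
have := is_derive_unique D1 (is_derive_cstf 1 z v).
by move=> /eqP; rewrite mulf_eq0 pnatr_eq0 => /eqP.
Qed.

Lemma frame_contact X N al be i z v : null_frame X N al be ->
  (chart M i @` dom M i) z ->
  lorentz ('D_v (X \o param M i) z) (N (param M i z)) =
  2 * be (param M i z) *
    ('D_v (al \o param M i) z * (1 - dot (x (param M i z)) (y (param M i z))) -
     al (param M i z) * \sum_(k < 3) 'D_v (fun w => x (param M i w) 0 k) z *
       y (param M i z) 0 k).
Proof.
move=> F Uz; have [sX _] := frame_smooth F; have [sal sbe prod XE NE] := F.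
have dX : is_derive z v (X \o param M i) ('D_v (X \o param M i) z).
  exact: Ck_on_is_derive (sX i 1%N) Uz.
have dal := smooth_derive v sal Uz; have dbe := smooth_derive v sbe Uz.
have dx k := smooth_derive v (sx k) Uz; have dy k := smooth_derive v (sy k) Uz.
rewrite /comp in dal dbe dx dy.
set P := param M i in dX dal dbe dx dy *.
have X0 : ('D_v (X \o P) z).1 = 'D_v (al \o P) z + 'D_v (be \o P) z.
  apply: is_derive_unique (is_derive_lin linear_fst continuous_fst dX) _.
  rewrite (_ : _ \o _ = fun w => al (P w) + be (P w)); first by derive_rules.
  by apply/funext => w; rewrite /= XE.
have Xk k : ('D_v (X \o P) z).2 0 k =
    'D_v (al \o P) z * x (P z) 0 k + al (P z) * 'D_v (fun w => x (P w) 0 k) z +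
    ('D_v (be \o P) z * y (P z) 0 k + be (P z) * 'D_v (fun w => y (P w) 0 k) z).
  have := is_derive_lin (@linear_snd_coord R k) (@continuous_snd_coord R k) dX.
  rewrite (_ : _ \o _ = fun w => al (P w) * x (P w) 0 k + be (P w) * y (P w) 0 k).
    have dxk := dx k; have dyk := dy k => D.
    apply: is_derive_unique D _; derive_by ltac:(idtac).
    by rewrite /comp; ring.
  by apply/funext => w; rewrite /= XE /= !mxE.
have d0 := dx j0; have d1 := dx j1; have d2 := dx j2.
have e0 := dy j0; have e1 := dy j1; have e2 := dy j2.
(* The normalization [frame_prod] is differentiated to obtain the last hypothesis of
   [frontal_contact]. *)
have D : is_derive z v (fun w => al (P w) * be (P w) *
      (1 - (x (P w) 0 j0 * y (P w) 0 j0 + x (P w) 0 j1 * y (P w) 0 j1 +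
            x (P w) 0 j2 * y (P w) 0 j2)))
    (('D_v (al \o P) z * be (P z) + al (P z) * 'D_v (be \o P) z) *
      (1 - \sum_(k < 3) x (P z) 0 k * y (P z) 0 k) -
     al (P z) * be (P z) *
     (\sum_(k < 3) 'D_v (fun w => x (P w) 0 k) z * y (P z) 0 k +
      \sum_(k < 3) x (P z) 0 k * 'D_v (fun w => y (P w) 0 k) z)).
  derive_by ltac:(idtac).
  by rewrite !sum3E /comp; ring.
rewrite (_ : (fun w => _) = (fun=> 2^-1)) in D; last first.
  by apply/funext => w; rewrite -dotE prod.
have /eqP := is_derive_unique D (is_derive_cstf _ z v).
rewrite subr_eq0 => /eqP E.
have := @frontal_contact R (al (P z)) (be (P z)) ('D_v (al \o P) z) ('D_v (be \o P) z)
  (fun k => x (P z) 0 k) (fun k => y (P z) 0 k)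
  (fun k => 'D_v (fun w => x (P w) 0 k) z) (fun k => 'D_v (fun w => y (P w) 0 k) z)
  (stereo_inv_unit _) (stereo_inv_unit _) (unit_derive v sx Uz) (unit_derive v sy Uz) E.
move=> <-; rewrite /lorentz NE X0 /=; congr (_ + _).
by apply: eq_bigr => k _; rewrite Xk !mxE.
Qed.

Lemma frame_frontal X N al be : null_frame X N al be ->
  (forall i z v, (chart M i @` dom M i) z ->
     'D_v (al \o param M i) z = al (param M i z) * chart_form x y i v z) ->
  frontal_with_normal M X N.
Proof.
move=> F dal; have [sX sN] := frame_smooth F.
split=> //.
- by split=> // p; have [] := frame_lorentz p F.
- by move=> p; have [] := frame_lorentz p F.
- by move=> p; have [] := frame_lorentz p F.
move=> i z v Uz; rewrite (frame_contact _ F Uz) dal//.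
rewrite /chart_form -[X in _ * (X - _)]mulrA divfK ?dot_neq1// subrr mulr0//.
Qed.

Lemma frontal_frame X N : frontal_with_normal M X N -> gauss_maps_are X N Gp Gm ->
  exists al be, null_frame X N al be.
Proof.
move=> [[sX XX] sN NN NX _] [gp gm].
exists (fun p => ((X p).1 + (N p).1) / 2), (fun p => ((X p).1 - (N p).1) / 2).
have sX1 := smooth_lin linear_fst continuous_fst sX.
have sN1 := smooth_lin linear_fst continuous_fst sN.
have key p : (X p).1 + (N p).1 != 0 /\ (X p).1 - (N p).1 != 0 /\
    (X p).2 + (N p).2 = ((X p).1 + (N p).1) *: x p /\
    (X p).2 - (N p).2 = ((X p).1 - (N p).1) *: y p.
  have := XX p; have := NN p; have := NX p; rewrite /lorentz.
  have := gp p; have := gm p; rewrite /gauss_plus /gauss_minus.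
  case: (X p) => X0 X2; case: (N p) => N0 N2 /= gmp gpp nx nn xx.
  have np : dot (X2 + N2) (X2 + N2) = (X0 + N0) ^+ 2.
    transitivity (dot X2 X2 + 2 * dot N2 X2 + dot N2 N2).
      by rewrite !dotE !mxE; ring.
    by move: nx nn xx; lra.
  have nm : dot (X2 - N2) (X2 - N2) = (X0 - N0) ^+ 2.
    transitivity (dot X2 X2 - 2 * dot N2 X2 + dot N2 N2).
      by rewrite !dotE !mxE; ring.
    by move: nx nn xx; lra.
  have dot0 w : dot w w = 0 :> R -> w = 0.
    rewrite dotE => /eqP; rewrite -!expr2 !paddr_eq0 ?addr_ge0 ?sqr_ge0// !sqrf_eq0.
    by move=> /andP[/andP[/eqP w0 /eqP w1] /eqP w2]; apply: rV3P; rewrite mxE.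
  (* X + N is null: if its time component vanished, so would the whole vector, and X = - N would
     contradict <<X, X>> = -1 and <<N, N>> = 1. The same argument with X = N handles X - N. *)
  have P0 : X0 + N0 != 0.
    apply/eqP => E; move: np; rewrite E expr0n/= => /dot0/eqP.
    rewrite addr_eq0 => /eqP XN; move: xx nn.
    rewrite XN (_ : X0 = - N0); last by apply/eqP; rewrite -addr_eq0 E.
    rewrite (_ : dot (- N2) (- N2) = dot N2 N2); first by lra.
    by rewrite !dotE !mxE; ring.
  have M0 : X0 - N0 != 0.
    apply/eqP => E; move: nm; rewrite E expr0n/= => /dot0/eqP.
    rewrite subr_eq0 => /eqP XN; move: xx nn.
    by rewrite XN (_ : X0 = N0); [lra|apply/eqP; rewrite -subr_eq0 E].
  by split=> //; split=> //; split; exact: null_direction.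
have XE p : X p = (((X p).1 + (N p).1) / 2 + ((X p).1 - (N p).1) / 2,
    (((X p).1 + (N p).1) / 2) *: x p + (((X p).1 - (N p).1) / 2) *: y p).
  have [_ [_ [E1 E2]]] := key p; rewrite [LHS]surjective_pairing; congr (_, _).
    by field.
  rewrite ![_ / 2]mulrC -!scalerA -E1 -E2; apply/rowP => k; rewrite !mxE; by field.
have NE p : N p = (((X p).1 + (N p).1) / 2 - ((X p).1 - (N p).1) / 2,
    (((X p).1 + (N p).1) / 2) *: x p - (((X p).1 - (N p).1) / 2) *: y p).
  have [_ [_ [E1 E2]]] := key p; rewrite [LHS]surjective_pairing; congr (_, _).
    by field.
  rewrite ![_ / 2]mulrC -!scalerA -E1 -E2; apply/rowP => k; rewrite !mxE; by field.
split=> //.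
- by apply: smoothM; [exact: smoothD|exact: smooth_cst].
- by apply: smoothM; [apply: smoothD => //; exact: smoothN|exact: smooth_cst].
move=> p; set A := _ / 2; set B := _ / 2.
have := XX p; rewrite XE -/A -/B.
have := stereo_inv_unit (Gp p); have := stereo_inv_unit (Gm p).
rewrite /lorentz !dotE !mxE /= => yy xx E.
apply: (mulfI (_ : 2 != 0)) => //; rewrite divff//.
set u := stereo_inv (Gp p) in xx E *; set w := stereo_inv (Gm p) in yy E *.
have e1 : A * A * (u 0 j0 * u 0 j0 + u 0 j1 * u 0 j1 + u 0 j2 * u 0 j2) = A * A.
  by rewrite xx mulr1.
have e2 : B * B * (w 0 j0 * w 0 j0 + w 0 j1 * w 0 j1 + w 0 j2 * w 0 j2) = B * B.
  by rewrite yy mulr1.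
by move: E e1 e2; lra.
Qed.

(** Since be does not vanish, [frame_contact] turns the contact condition into d al = al w, which is
    integrated along the path. Around a loop the nonzero al returns to its value, so w has no
    periods. *)
Lemma frame_transport X N al be c r s : null_frame X N al be ->
  frontal_with_normal M X N -> is_path M r c s ->
  al s = al r * expR (path_int x y c).
Proof.
move=> F [_ _ _ _ contact].
have dal i z v : (chart M i @` dom M i) z ->
    'D_v (al \o param M i) z = al (param M i z) * chart_form x y i v z.
  move=> Uz; have := contact i z v Uz; rewrite (frame_contact _ F Uz).
  have [_ b0] := frame_neq0 (param M i z) F.
  move=> /eqP; rewrite !mulf_eq0 pnatr_eq0 (negbTE b0)/= subr_eq0 => /eqP E.
  by rewrite /chart_form mulrA -E mulfK//; exact: (dot_neq1 xy1).
elim: c r => [|a c IH] r /=.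
  by move=> ->; rewrite /path_int big_nil expR0 mulr1.
move=> [sa <- /IH ->]; rewrite /path_int big_cons -/(path_int _ _ c) expRD mulrA.
congr (_ * _); have [P [dP ->]] := arc_primitive sx sy xy1 sa.
apply: (@linear_ode _ P (arc_form x y a) (al \o a) dP) => t t01.
have [U [oU sU ca]] := sa.
have Ut : U t by apply: sU; rewrite /= in_itv.
have [i iat] := @surf_cover R S M (a t).
have Uz := chart_image iat.
have [_ /(_ i iat) D] := smooth_along oU ca (frame_al F) Ut.
rewrite dal// in D; rewrite /= chartK// in D.
apply: is_derive_eqf D _; congr (_ * _).
rewrite /chart_form /arc_form !chartK//; congr (_ / _).
apply: eq_bigr => k _; congr (_ * _).
have [_ /(_ i iat) [_]] := smooth_along oU ca (sx k) Ut.
by rewrite derive1E => ->.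
Qed.

End Frontal.

(** * Periods, existence and representation of frontals *)

Section GaussMaps.
Context {R : realType} {S : topologicalType} (M : oriented_surface R S).

Lemma along_nth (a0 : R -> S) (c : seq (R -> S)) (P : S -> Prop) :
  (forall i, (i < size c)%N -> forall t : R, 0 <= t <= 1 -> P (nth a0 c i t)) ->
  along c P.
Proof.
elim: c => [|a c IH] //= H; split; first by move=> t; exact: (H 0%N).
by apply: IH => i ic; exact: (H i.+1).
Qed.

Lemma is_path_nth (a0 : R -> S) (c : seq (R -> S)) p q i :
  is_path M p c q -> (i < size c)%N -> smooth_arc M (nth a0 c i).
Proof.
elim: c p i => [|a c IH] p [|i] //= [sa _ pc] ic; first exact: sa.
exact: IH pc ic.
Qed.

(** The rotation takes the unit vector (z, w, e) with e >= 0 to the pole: the third coordinate of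
    the rotated n is <n, (z, w, e)>, which is 1 only at n = (z, w, e). *)
Lemma rotation_to_pole (z w : R) : 0 <= z <= 2^-1 -> 0 <= w <= 2^-1 ->
  exists a b : R[i], normc a ^+ 2 + normc b ^+ 2 = 1 /\
    forall n : 'rV[R]_3, dot n n = 1 -> rot a b n 0 j2 = 1 ->
      n 0 j0 = z /\ n 0 j1 = w.
Proof.
move=> /andP[z0 z1] /andP[w0 w1].
have s0 : 0 <= 1 - z ^+ 2 - w ^+ 2 by nra.
pose e := Num.sqrt (1 - z ^+ 2 - w ^+ 2).
have e0 : 0 <= e by exact: sqrtr_ge0.
have eE : e ^+ 2 = 1 - z ^+ 2 - w ^+ 2 by rewrite sqr_sqrtr.
(* Half-angle formula: e is the cosine of the rotation angle and [a] that of its half, nonzero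
   because e >= 0. *)
pose a := Num.sqrt ((1 + e) / 2).
have a2 : a ^+ 2 = (1 + e) / 2 by rewrite sqr_sqrtr// divr_ge0// addr_ge0.
have a0 : a != 0.
  by apply/eqP => E; move: a2; rewrite E expr0n/=; move: e0; lra.
exists (a +i* 0), ((z / (2 * a)) +i* (w / (2 * a))).
have bb : (z / (2 * a)) ^+ 2 + (w / (2 * a)) ^+ 2 = (1 - e) / 2.
  have -> : (z / (2 * a)) ^+ 2 + (w / (2 * a)) ^+ 2 =
    (1 - (1 - z ^+ 2 - w ^+ 2)) / (4 * a ^+ 2) by field.
  by rewrite a2 -eE; field; apply/eqP; move: e0; lra.
split.
  by rewrite !normc2E /= bb expr0n/= addr0 a2; field.
move=> n n1; have -> : rot (a +i* 0) ((z / (2 * a)) +i* (w / (2 * a))) n 0 j2 =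
    (a ^+ 2 - ((z / (2 * a)) ^+ 2 + (w / (2 * a)) ^+ 2)) * n 0 j2
    + z * n 0 j0 + w * n 0 j1.
  by rewrite /rot !vec3E; field.
rewrite bb a2 (_ : (1 + e) / 2 - (1 - e) / 2 = e); last by field.
move=> en; rewrite dotE in n1.
have : (n 0 j0 - z) ^+ 2 + (n 0 j1 - w) ^+ 2 + (n 0 j2 - e) ^+ 2 = 0.
  by move: n1 en eE; lra.
move/eqP; rewrite !paddr_eq0 ?addr_ge0 ?sqr_ge0// !sqrf_eq0 !subr_eq0.
by move=> /andP[/andP[/eqP -> /eqP ->] _].
Qed.

Lemma path_rotation (G : S -> riemann_sphere R) p c q :
  (forall k, smooth_map M (fun r => stereo_inv (G r) 0 k)) -> is_path M p c q ->
  exists a b : R[i], normc a ^+ 2 + normc b ^+ 2 = 1 /\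
    along c (fun r => rotation a b (G r) <> None).
Proof.
move=> sG pc; pose a0 : R -> S := fun=> p.
have sarc (i : 'I_(size c)) : smooth_arc M (nth a0 c i).
  by apply: is_path_nth pc _; exact: ltn_ord.
pose n k (i : nat) (t : R) : R := stereo_inv (G (nth a0 c i t)) 0 k.
have lip k : exists K : 'I_(size c) -> R, forall i, 0 <= K i /\
    forall s t : R, 0 <= s <= 1 -> 0 <= t <= 1 ->
      `|n k i s - n k i t| <= K i * `|s - t|.
  have ex (i : 'I_(size c)) : exists K : R, 0 <= K /\
      forall s t : R, 0 <= s <= 1 -> 0 <= t <= 1 ->
        `|n k i s - n k i t| <= K * `|s - t|.
    apply: C1_lipschitz => t t01.
    exact: (smooth_arc_C1 (sarc i) (sG k) t01).
  by have [K KP] := choice ex; exists K => i; exact: KP.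
have [K KP] := lip j0; have [L LP] := lip j1.
have le_sum (F : 'I_(size c) -> R) i : (forall j, 0 <= F j) -> F i <= \sum_j F j.
  by move=> F0; rewrite (bigD1 i)//= lerDl sumr_ge0.
(* The sum of all the constants serves every piece and both coordinates. *)
have bound (i : 'I_(size c)) (s t : R) : 0 <= s <= 1 -> 0 <= t <= 1 ->
    `|n j0 i s - n j0 i t| <= (\sum_i K i + \sum_i L i) * `|s - t| /\
    `|n j1 i s - n j1 i t| <= (\sum_i K i + \sum_i L i) * `|s - t|.
  have K0 : 0 <= \sum_i K i by apply: sumr_ge0 => j _; exact: (KP j).1.
  have L0 : 0 <= \sum_i L i by apply: sumr_ge0 => j _; exact: (LP j).1.
  move=> s01 t01; split.
    apply: (le_trans ((KP i).2 s t s01 t01)); rewrite ler_wpM2r//.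
    apply: (le_trans (le_sum K i (fun j => (KP j).1))).
    by rewrite lerDl.
  apply: (le_trans ((LP i).2 s t s01 t01)); rewrite ler_wpM2r//.
  apply: (le_trans (le_sum L i (fun j => (LP j).1))).
  by rewrite lerDr.
have [z [w [z01 w01 miss]]] := lipschitz_curves_miss bound.
have [a [b [ab abP]]] := rotation_to_pole z01 w01.
exists a, b; split=> //; apply: (@along_nth a0) => i ic t t01.
move=> /stereo_inv2; rewrite stereo_inv_rotation// => E.
apply: (miss (Ordinal ic) t t01).
by have [] := abP _ (stereo_inv_unit (G (nth a0 c i t))) E.
Qed.

Variables Gp Gm : S -> riemann_sphere R.
Hypothesis Gp_smooth : smooth_to_sphere M Gp.
Hypothesis Gm_smooth : smooth_to_sphere M Gm.
Hypothesis Gpm : forall p, Gp p <> Gm p.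
Local Notation x := (stereo_inv \o Gp).
Local Notation y := (stereo_inv \o Gm).

Let sx k : smooth_map M (fun p => x p 0 k) := smooth_coord k Gp_smooth.
Let sy k : smooth_map M (fun p => y p 0 k) := smooth_coord k Gm_smooth.

Lemma gauss_dot_neq1 p : dot (x p) (y p) != 1.
Proof.
apply/eqP => E; apply: (Gpm (p := p)).
have := stereo_inv_unit (Gp p); have := stereo_inv_unit (Gm p).
move: E; rewrite /= !dotE => E yy xx.
rewrite -[LHS]stereo_invK -[RHS]stereo_invK; congr stereo.
have : (stereo_inv (Gp p) 0 j0 - stereo_inv (Gm p) 0 j0) ^+ 2 +
   (stereo_inv (Gp p) 0 j1 - stereo_inv (Gm p) 0 j1) ^+ 2 +
   (stereo_inv (Gp p) 0 j2 - stereo_inv (Gm p) 0 j2) ^+ 2 = 0.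
  by move: E xx yy; lra.
move/eqP; rewrite !paddr_eq0 ?addr_ge0 ?sqr_ge0// !sqrf_eq0 !subr_eq0.
by move=> /andP[/andP[/eqP ? /eqP ?] /eqP ?]; exact: rV3P.
Qed.

Lemma dot_le1 z w : dot (stereo_inv z) (stereo_inv w) <= 1 :> R.
Proof.
have := stereo_inv_unit z; have := stereo_inv_unit w; rewrite !dotE => ww zz.
have := sqr_ge0 (stereo_inv z 0 j0 - stereo_inv w 0 j0).
have := sqr_ge0 (stereo_inv z 0 j1 - stereo_inv w 0 j1).
have := sqr_ge0 (stereo_inv z 0 j2 - stereo_inv w 0 j2).
by move: ww zz; lra.
Qed.

Section Rotated.
Variables a b : R[i].
Hypothesis ab : normc a ^+ 2 + normc b ^+ 2 = 1.
Local Notation g := (rotation a b \o Gp).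
Local Notation h := (rotation a b \o Gm).

Lemma stereo_inv_rotated G : stereo_inv \o (rotation a b \o G) =
  rot a b \o (stereo_inv \o G) :> (S -> 'rV[R]_3).
Proof. by apply/funext => p; exact: stereo_inv_rotation. Qed.

Lemma rotated_smooth G : (forall k, smooth_map M (fun p => stereo_inv (G p) 0 k)) ->
  forall k, smooth_map M (fun p => (stereo_inv \o (rotation a b \o G)) p 0 k).
Proof. by move=> sG; rewrite stereo_inv_rotated; exact: rot_smooth. Qed.

Lemma rotated_dot p : dot (stereo_inv (g p)) (stereo_inv (h p)) = dot (x p) (y p).
Proof. by rewrite /= !stereo_inv_rotation// dot_rot. Qed.

Lemma rotated_neq p : g p <> h p.
Proof.
move=> E; have := gauss_dot_neq1 p; rewrite -rotated_dot E stereo_inv_unit.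
by rewrite eqxx.
Qed.

(** The integral of w is kept in the original coordinates: it is the part that does not depend on
    [a] and [b]. *)
Lemma rotated_transport c r s : is_path M r c s -> along c (fun p => g p <> None) ->
  1 - stereo_inv (g s) 0 j2 = (1 - stereo_inv (g r) 0 j2) *
    expR (- 2 * complex.Re (path_integral g h c) - path_int x y c).
Proof.
move=> pc gc; rewrite -(path_int_rot y sx ab pc) -!stereo_inv_rotated.
apply: (transport_path (rotated_smooth sx) (rotated_smooth sy) _ pc gc) => p.
by rewrite /= rotated_dot gauss_dot_neq1.
Qed.

End Rotated.

Lemma expR_eq1 (r : R) : expR r = 1 -> r = 0.
Proof. by move=> E; apply: expR_inj; rewrite E expR0. Qed.

Lemma period_loops : period_condition M Gp Gm ->
  forall p c, is_path M p c p -> path_int x y c = 0.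
Proof.
(* On the empty path [along] says nothing about its base point, so finiteness of g at p is available
   only for a nonempty loop. *)
move=> per p [|a0 c] pc; first by rewrite /path_int big_nil.
have [a [b [ab gc]]] := path_rotation sx pc.
have E := rotated_transport ab pc gc.
have gp : rotation a b (Gp p) <> None.
  have [_ a0p _] := pc; rewrite -a0p; apply: (gc.1 0).
  by rewrite lexx ler01.
have d0 := stereo_inv2_neq gp.
move: E; rewrite (per a b ab p _ pc gc) mulr0 sub0r -[LHS]mulr1.
by move=> /(mulfI d0)/esym/expR_eq1; lra.
Qed.

Lemma frontal_period X N : frontal_with_normal M X N -> gauss_maps_are X N Gp Gm ->
  period_condition M Gp Gm.
Proof.
move=> XN gN a b ab g h p [|a0 c] pc gc.
  by rewrite /path_integral big_nil.
have [al [be F]] := frontal_frame XN gN.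
have E := frame_transport sx sy gauss_dot_neq1 F XN pc.
have [al0 _] := frame_neq0 p F.
have int0 : path_int x y (a0 :: c) = 0.
  by move: E; rewrite -[LHS]mulr1 => /(mulfI al0)/esym/expR_eq1.
have := rotated_transport ab pc gc; rewrite int0 subr0.
have gp : rotation a b (Gp p) <> None.
  have [_ a0p _] := pc; rewrite -a0p; apply: (gc.1 0).
  by rewrite lexx ler01.
have d0 := stereo_inv2_neq gp.
rewrite -[LHS]mulr1 => /(mulfI d0)/esym/expR_eq1; rewrite -/g -/h.
by lra.
Qed.

(** al is A times the exponential of a primitive of w, and be is forced by the product. As 1 - <n+,
    n-> > 0, al and be have the same sign, so the sign of the free constant [A] selects the sheet of
    the hyperboloid. *)
Lemma period_frontal : period_condition M Gp Gm -> forall p0 (A : R), A != 0 ->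
  exists X N al be, [/\ null_frame M Gp Gm X N al be, frontal_with_normal M X N
    & al p0 = A].
Proof.
move=> per p0 A A0.
have [I IP] := path_primitive sx sy gauss_dot_neq1 (period_loops per).
have sI := primitive_smooth sx sy gauss_dot_neq1 IP.
pose al p := A * expR (I p - I p0).
pose be p := 2^-1 * (al p * (1 - dot (x p) (y p)))^-1.
pose X p := (al p + be p, al p *: x p + be p *: y p).
pose N p := (al p - be p, al p *: x p - be p *: y p).
have al0 p : al p != 0 by rewrite mulf_neq0// gt_eqF// expR_gt0.
have xy0 p : 1 - dot (x p) (y p) != 0 := dot_neq1 gauss_dot_neq1 p.
have sal : smooth_map M al.
  apply: smoothM; first exact: smooth_cst.
  apply: smooth_expR; apply: smoothD => //; exact: smooth_cst.
have sdot : smooth_map M (fun p => dot (x p) (y p)).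
  move=> i n; apply: Ck_on_sum; first exact: chart_image_open.
  by move=> k; exact: (smoothM (sx k) (sy k) i n).
have F : null_frame M Gp Gm X N al be.
  split=> // [|p].
    apply: smoothM; first exact: smooth_cst.
    apply: smoothV => [p|]; first by rewrite mulf_neq0.
    apply: smoothM => //; apply: smoothD; first exact: smooth_cst.
    exact: smoothN.
  by rewrite /be; field; rewrite al0 xy0.
exists X, N, al, be; split=> //; last by rewrite /al subrr expR0 mulr1.
apply: (frame_frontal sx sy gauss_dot_neq1 F) => i z v Uz.
have dI := primitive_in_chart sx sy gauss_dot_neq1 IP v Uz.
apply: derive_val.
rewrite (_ : al \o param M i = fun w => A * expR ((I \o param M i) w - I p0))//.
derive_by ltac:(idtac).
by rewrite /al /=; ring.
Qed.

Lemma normc_cexp (z : R[i]) : normc (cexp z) ^+ 2 = expR (2 * complex.Re z).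
Proof.
rewrite normc2E /= !exprMn -mulrDr cos2Dsin2 mulr1 -expRM_natl.
by congr expR; rewrite mulr_natl.
Qed.

Lemma normc2M (z w : R[i]) : normc (z * w) ^+ 2 = normc z ^+ 2 * normc w ^+ 2.
Proof. by rewrite !normc2E; case: z => ? ?; case: w => ? ? /=; ring. Qed.

Lemma normc2_neq0 (z : R[i]) : z != 0 -> normc z ^+ 2 != 0.
Proof.
case: z => u v; apply: contra; rewrite normc2E /= paddr_eq0 ?sqr_ge0// !sqrf_eq0.
by move=> /andP[/eqP-> /eqP->].
Qed.

(** The value prescribed for [al p0] is -1/(2 rho^+) at p0. Transport of al and of 1 - n_3 carries
    this relation along the path, the exponentials of the integral of w matching; be then follows
    from the product. *)
Lemma frame_represented X N al be a b p0 c0 c1 : null_frame M Gp Gm X N al be ->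
  frontal_with_normal M X N -> normc a ^+ 2 + normc b ^+ 2 = 1 ->
  rotation a b (Gp p0) <> None -> c0 != 0 -> c1 != 0 ->
  c0 * c1 = affine (rotation a b (Gp p0)) - affine (rotation a b (Gm p0)) ->
  rotation a b (Gm p0) <> None ->
  al p0 = - ((1 + normc (affine (rotation a b (Gp p0))) ^+ 2) /
             (2 * normc c0 ^+ 2)) ->
  represented M Gp Gm X N a b p0 c0 c1.
Proof.
move=> F XN ab gp0 c00 c10 cc hp0 alp0 g h c q pc fin xip xim rhop rhom.
have gc : along c (fun r => g r <> None).
  by elim: c fin {pc xip xim rhop rhom} => //= d c IH [H /IH]; split=> // t /H[].
(* For the empty path this comes from the hypotheses at p0. *)
have [gq hq] : g q <> None /\ h q <> None.
  elim: c p0 pc fin gp0 hp0 {cc alp0 gc xip xim rhop rhom} => [|d c IH] p0 /=.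
    by move=> <-.
  move=> [_ _ pc] [H1 H2] _ _.
  have r1 : 0 <= (1 : R) <= 1 by rewrite ler01 lexx.
  by have [H3 H4] := H1 1 r1; exact: IH pc H2 H3 H4.
have E1 : xip * xim = affine (g q) - affine (h q).
  rewrite (difference_path (rotated_smooth ab sx) (rotated_smooth ab sy)
    (rotated_neq ab) pc fin) -[affine (g p0) - _]cc /xip /xim; ring.
have Eal := frame_transport sx sy gauss_dot_neq1 F XN pc.
have Eg := rotated_transport ab pc gc.
have dp := stereo_inv2_neq gp0; have dq := stereo_inv2_neq gq.
have eq := stereo_inv2_neq hq.
have c0n := normc2_neq0 c00; have c1n := normc2_neq0 c10.
have xipn : normc xip ^+ 2 != 0.
  by rewrite /xip normc2M normc_cexp mulf_neq0// gt_eqF// expR_gt0.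
have ximn : normc xim ^+ 2 != 0.
  by rewrite /xim normc2M normc_cexp mulf_neq0// gt_eqF// expR_gt0.
have alq : al q = - (1 / (2 * rhop)).
  rewrite /rhop one_plus_normc2// Eal alp0 one_plus_normc2// Eg.
  rewrite /xip normc2M normc_cexp -/g -/h.
  set Z := complex.Re _; set W := path_int _ _ _.
  have -> : - 2 * Z - W = - (2 * Z + W) by ring.
  rewrite expRN expRD.
  have := expR_gt0 (2 * Z); have := expR_gt0 W.
  move=> /lt0r_neq0 W0 /lt0r_neq0 Z0.
  move: dp c0n; rewrite -/g.
  set d := 1 - _; set n0 := normc c0 ^+ 2 => dp c0n.
  by field; rewrite ?dp ?c0n ?W0 ?Z0.
have beq : be q = - (1 / (2 * rhom)).
  have [al0 _] := frame_neq0 q F.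
  have := frame_prod F q.
  have xy0 : 1 - dot (x q) (y q) != 0 := dot_neq1 gauss_dot_neq1 q.
  move=> prod.
  (* |xi_+ xi_-|^2 = |g - h|^2 is a chordal distance, expressed by [stereo_dist]. *)
  have rr : rhop * rhom = (1 - dot (x q) (y q)) / 2.
    have := stereo_dist (m0 := stereo_inv (g q) 0 j0) (m1 := stereo_inv (g q) 0 j1)
      (m2 := stereo_inv (g q) 0 j2) (l0 := stereo_inv (h q) 0 j0)
      (l1 := stereo_inv (h q) 0 j1) (l2 := stereo_inv (h q) 0 j2).
    have := stereo_inv_unit (g q); have := stereo_inv_unit (h q).
    rewrite !dotE => hh gg /(_ gg hh dq eq).
    have -> : (stereo_inv (g q) 0 j0 / (1 - stereo_inv (g q) 0 j2) -
       stereo_inv (h q) 0 j0 / (1 - stereo_inv (h q) 0 j2)) ^+ 2 +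
      (stereo_inv (g q) 0 j1 / (1 - stereo_inv (g q) 0 j2) -
       stereo_inv (h q) 0 j1 / (1 - stereo_inv (h q) 0 j2)) ^+ 2 =
      normc xip ^+ 2 * normc xim ^+ 2.
      by rewrite -normc2M E1 normc2E !affineE.
    rewrite -!dotE rotated_dot// => nn.
    rewrite /rhop /rhom !one_plus_normc2//.
    set d := 1 - stereo_inv (g q) 0 j2 in dq nn *.
    set e := 1 - stereo_inv (h q) 0 j2 in eq nn *.
    have -> : normc xip ^+ 2 / (2 / d) * (normc xim ^+ 2 / (2 / e)) =
      normc xip ^+ 2 * normc xim ^+ 2 * d * e / 4 by field; rewrite dq eq.
    by rewrite nn; field; rewrite dq eq.
  have rp0 : rhop != 0.
    by rewrite /rhop one_plus_normc2// mulf_neq0// invr_eq0 mulf_neq0 ?invr_eq0//.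
  have rm0 : rhom != 0.
    by rewrite /rhom one_plus_normc2// mulf_neq0// invr_eq0 mulf_neq0 ?invr_eq0//.
  have D : 1 - dot (x q) (y q) = 2 * (rhop * rhom) by rewrite rr; field.
  move: prod; rewrite D alq => prod.
  (* Rewrites be as a multiple of the left side of [prod], whose value is 1/2. *)
  have -> : be q = - (2 * ((- (1 / (2 * rhop))) * be q * (2 * (rhop * rhom)))) / (2 * rhom).
    by field; rewrite rp0 rm0.
  by rewrite prod; field.
split=> //.
- rewrite (frame_X F) -alq -scaleNr -beq.
  by rewrite [RHS]surjective_pairing; congr (_, _) => /=; rewrite [_ *: 1]mulr1 [_ *: 1]mulr1.
- rewrite (frame_N F) -alq -[1 / (2 * rhom)]opprK -beq scaleNr.
  by rewrite [RHS]surjective_pairing; congr (_, _) => /=; rewrite [_ *: 1]mulr1 [_ *: 1]mulr1.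
Qed.

(** The change of sign exchanges the two sheets and keeps the null directions, hence both Gauss
    maps. *)
Lemma frame_opp X N al be : null_frame M Gp Gm X N al be ->
  null_frame M Gp Gm (fun p => - X p) (fun p => - N p) (fun p => - al p)
    (fun p => - be p).
Proof.
move=> [sal sbe prod XE NE]; split.
- exact: smoothN.
- exact: smoothN.
- by move=> p; rewrite mulrNN.
- by move=> p; rewrite XE !scaleNr -opprD -opprD.
- by move=> p; rewrite NE !scaleNr -!opprD.
Qed.

Lemma frontal_opp X N : frontal_with_normal M X N ->
  frontal_with_normal M (fun p => - X p) (fun p => - N p).
Proof.
have lin : linear (fun u : R * 'rV[R]_3 => - u).
  by move=> k u v; rewrite opprD scalerN.
have con : continuous (fun u : R * 'rV[R]_3 => - u).
  by move=> u; apply: (@cvgN _ (R * 'rV[R]_3)%type); exact: cvg_id.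
have lN (u v : R * 'rV[R]_3) : lorentz (- u) (- v) = lorentz u v.
  by rewrite /lorentz !dotE !mxE /=; ring.
move=> [[sX XX] sN NN NX D]; split.
- by split=> [|p]; [exact: (smooth_lin lin con sX)|rewrite lN].
- exact: (smooth_lin lin con sN).
- by move=> p; rewrite lN.
- by move=> p; rewrite lN.
move=> i z v Uz.
have dX : is_derive z v (X \o param M i) ('D_v (X \o param M i) z).
  exact: Ck_on_is_derive (sX i 1%N) Uz.
have [_] := is_derive_lin lin con dX.
rewrite (_ : _ \o (X \o _) = (fun p => - X p) \o param M i)// => ->.
by rewrite lN D.
Qed.

End GaussMaps.

Theorem theorem2p4 (R : realType) (S : topologicalType)
    (M : oriented_surface R S) (Gp Gm : S -> riemann_sphere R)
    (Gp_smooth : smooth_to_sphere M Gp) (Gm_smooth : smooth_to_sphere M Gm)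
    (Gpm : forall p, Gp p <> Gm p) :
  ((exists X N, frontal_with_normal M X N /\ gauss_maps_are X N Gp Gm)
     <-> period_condition M Gp Gm)
  /\
  (period_condition M Gp Gm ->
   forall (a b : R[i]) (p0 : S),
     normc a ^+ 2 + normc b ^+ 2 = 1 ->
     rotation a b (Gp p0) <> None -> rotation a b (Gm p0) <> None ->
     (forall c0 c1 : R[i], c0 != 0 -> c1 != 0 ->
        c0 * c1 = affine (rotation a b (Gp p0)) - affine (rotation a b (Gm p0)) ->
        exists X N, [/\ frontal_with_normal M X N, gauss_maps_are X N Gp Gm
                       & represented M Gp Gm X N a b p0 c0 c1])
     /\
     (forall X N, frontal_with_normal M X N -> gauss_maps_are X N Gp Gm ->
        exists c0 c1 : R[i], [/\ c0 != 0, c1 != 0,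
          ((X p0).1 < 0 -> represented M Gp Gm X N a b p0 c0 c1)
        & (0 < (X p0).1 -> represented M Gp Gm (fun p => - X p) (fun p => - N p)
                             a b p0 c0 c1)])).
Proof.
have sx k := smooth_coord k Gp_smooth; have sy k := smooth_coord k Gm_smooth.
have xy1 := gauss_dot_neq1 Gpm.
split; first split.
- by move=> [X [N [XN gN]]]; exact: (frontal_period Gp_smooth Gm_smooth Gpm XN gN).
(* On the empty surface there is no base point, and constant maps do. *)
- move=> per; have [[p0 _]|S0] := pselect (exists p : S, True); last first.
    exists (fun=> 0), (fun=> 0); split; last by split=> p; case: S0; exists p.
    split; try by move=> p; case: S0; exists p.
    - by split=> [|p]; [exact: smooth_cst|case: S0; exists p].
    - exact: smooth_cst.
    - by move=> i z v [p]; case: S0; exists p.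
  have [X [N [al [be [F XN _]]]]] :=
    period_frontal Gp_smooth Gm_smooth Gpm per p0 (oner_neq0 R).
  by exists X, N; split=> //; exact: (frame_gauss F).
move=> per a b p0 ab gp0 hp0; split.
  move=> c0 c1 c00 c10 cc.
  (* The value that [frame_represented] requires of al at p0. *)
  have A0 : - ((1 + normc (affine (rotation a b (Gp p0))) ^+ 2) /
             (2 * normc c0 ^+ 2)) != 0.
    rewrite oppr_eq0 mulf_neq0//; first by apply: normc2_gt0; exact: sqr_ge0.
    by rewrite invr_eq0 mulf_neq0// ?pnatr_eq0//; exact: normc2_neq0.
  have [X [N [al [be [F XN alp0]]]]] :=
    period_frontal Gp_smooth Gm_smooth Gpm per p0 A0.
  exists X, N; split=> //; first exact: (frame_gauss F).
  exact: (frame_represented Gp_smooth Gm_smooth Gpm F XN ab gp0 c00 c10 cc hp0 alp0).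
move=> X N XN gN.
have [al [be F]] := frontal_frame XN gN.
have [al0 be0] := frame_neq0 p0 F.
pose n := 1 + normc (affine (rotation a b (Gp p0))) ^+ 2.
have n0 : 0 < n by rewrite ltr_pwDl// sqr_ge0.
(* The modulus of c0 is dictated by n / (2 |c0|^2) = |al p0|; its argument is free, so c0 is taken
   real. *)
pose r := Num.sqrt (n / (2 * `|al p0|)).
have r2 : r ^+ 2 = n / (2 * `|al p0|).
  by rewrite sqr_sqrtr// divr_ge0 ?mulr_ge0// ltW.
have al0' : 0 < `|al p0| by rewrite normr_gt0.
have r0 : r != 0.
  by rewrite gt_eqF// sqrtr_gt0 divr_gt0// mulr_gt0.
pose c0 : R[i] := r +i* 0.
have c00 : c0 != 0 by rewrite eq_complex/= negb_and r0.
have d0 : affine (rotation a b (Gp p0)) - affine (rotation a b (Gm p0)) != 0.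
  rewrite subr_eq0; have := @rotated_neq _ _ _ _ Gpm _ _ ab p0 => /=.
  case: (rotation a b (Gp p0)) gp0 => [u|]// _.
  case: (rotation a b (Gm p0)) hp0 => [w|]// _ /= uw.
  by apply/eqP => E; apply: uw; rewrite E.
pose c1 := (affine (rotation a b (Gp p0)) - affine (rotation a b (Gm p0))) / c0.
have c10 : c1 != 0 by rewrite mulf_neq0// invr_eq0.
have cc : c0 * c1 = affine (rotation a b (Gp p0)) - affine (rotation a b (Gm p0)).
  by rewrite mulrC divfK.
have nc0 : normc c0 ^+ 2 = n / (2 * `|al p0|) by rewrite normc2E/= expr0n/= addr0.
have nn : n / (2 * (n / (2 * `|al p0|))) = `|al p0|.
  by field; rewrite !gt_eqF.
(* al and be have the same sign, so the sign of the time coordinate al + be is that of al. *)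
have sgn : 0 < al p0 * be p0.
  have d1 : 0 < 1 - dot (stereo_inv (Gp p0)) (stereo_inv (Gm p0)).
    by rewrite subr_gt0 lt_def eq_sym xy1 dot_le1.
  by rewrite -(pmulr_lgt0 _ d1) [X in 0 < X](frame_prod F p0) invr_gt0 ltr0n.
exists c0, c1; split=> //.
- rewrite (frame_X F)/= => X0; have aln : al p0 < 0 by nra.
  apply: (frame_represented Gp_smooth Gm_smooth Gpm F XN ab gp0 c00 c10 cc hp0).
  by rewrite nc0 -/n nn ltr0_norm// opprK.
(* On the positive sheet the frame of - X has the negative al that the formula requires. *)
- rewrite (frame_X F)/= => X0; have alp : 0 < al p0 by nra.
  apply: (frame_represented Gp_smooth Gm_smooth Gpm (frame_opp F) (frontal_opp XN)
    ab gp0 c00 c10 cc hp0).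
  by rewrite nc0 -/n nn gtr0_norm.
Qed.
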